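(* Let $(w_k)_{k\ge 0}$ be a sequence of positive real numbers and assume that there exists some $\alpha\in[0,1/2)$ such that $w_k\asymp (k+1)^\alpha$, i.e. $w_k/(k+1)^\alpha$ is bounded above and below by positive constants. Then the vertex reinforced random walk $(X_n)_{n\ge 0}$ on $\mathbb{Z}$ with weight $(w_k)_{k\ge0}$ is either almost surely recurrent or almost surely transient. That is, the set $R'$ of sites of $\mathbb{Z}$ visited infinitely often by $X$ is either almost surely equal to $\mathbb{Z}$ or almost surely empty.
   Context: The vertex reinforced random walk (VRRW) on $\mathbb{Z}$ with weight $(w_k)_{k\ge0}$ is the process $(X_n)_{n\ge0}$ with $X_0=0$ and, for all $n\ge 0$, on the event $\{X_n=x\}$, $$\mathbb{P}(X_{n+1}=X_n\pm1\mid \mathcal{F}_n)=\frac{w_{Z_n(x\pm1)}}{w_{Z_n(x-1)}+w_{Z_n(x+1)}},$$ where $(\mathcal{F}_n)$ is the natural filtration of $X$ and $Z_n(y)=\#\{m\le n: X_m=y\}$ is the local time at $y$ at time $n$. The walk is called recurrent if every site is visited infinitely often and transient if every site is visited only finitely many times. *)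

(* Defs.v *)
From HB Require Import structures.
From mathcomp Require Import all_boot all_order all_algebra.
From mathcomp Require Import all_classical all_reals all_analysis.
Set Implicit Arguments. Unset Strict Implicit. Unset Printing Implicit Defensive.
Import Order.TTheory GRing.Theory Num.Theory.
Local Open Scope ring_scope.
Local Open Scope classical_set_scope.

Definition loc_time (s : seq int) (y : int) : nat := count (pred1 y) s.

Definition vrrw_step (R : realType) (w : nat -> R) (s : seq int) (y : int) : R :=
  let x := last 0%R s in
  let wl := w (loc_time s (x - 1)%R) in
  let wr := w (loc_time s (x + 1)%R) in
  if y == (x + 1)%R then wr / (wl + wr)
  else if y == (x - 1)%R then wl / (wl + wr)
  else 0.

Definition path_event (T : Type) (X : nat -> T -> int) (s : seq int) : set T :=
  [set om | forall i, (i < size s)%N -> X i om = nth 0%R s i].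

(* X is a VRRW on Z started at 0 with weight w (on the probability space P):
   X_0 = 0 a.s., and for the natural filtration, the conditional law of X_{n+1}
   given F_n is vrrw_step w (X_0..X_n); written out for a discrete process as
   P(X_0..X_n = s, X_{n+1} = y) = P(X_0..X_n = s) * vrrw_step w s y. *)
Definition is_vrrw (d : measure_display) (T : measurableType d) (R : realType)
  (P : probability T R) (w : nat -> R) (X : nat -> T -> int) : Prop :=
  (forall n (x : int), measurable [set om | X n om = x]) /\
  P [set om | X 0%N om = 0%R] = 1%E /\
  forall (s : seq int) (y : int), size s != 0%N ->
    P (path_event X (rcons s y)) = (P (path_event X s) * (vrrw_step w s y)%:E)%E.

Definition recurrent_path (T : Type) (X : nat -> T -> int) : set T :=
  [set om | forall y : int, forall N : nat, exists2 n : nat, (N <= n)%N & X n om = y].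

Definition transient_path (T : Type) (X : nat -> T -> int) : set T :=
  [set om | forall y : int, exists N : nat, forall n : nat, (N <= n)%N -> X n om != y].

(* Main.v *)
Require Import Defs.
From HB Require Import structures.
From mathcomp Require Import all_boot all_order all_algebra.
From mathcomp Require Import all_classical all_reals all_analysis.
From mathcomp Require Import zify ring lra.
Import Order.TTheory GRing.Theory Num.Theory.
Local Open Scope ring_scope.
Local Open Scope classical_set_scope.
Set Implicit Arguments. Unset Strict Implicit. Unset Printing Implicit Defensive.

(** Write [Z(x)] for the local time at [x]. Adding [1 / w (Z(x - 1))] at each jump from [x] to
    [x - 1] and subtracting [1 / w (Z(x + 1))] at each jump from [x] to [x + 1] gives a martingale
    [M(x)] with bounded increments, so when [Z(x) = N] it is unlikely to exceed
    [e N `^ (1 - al)], because [1 - al > 1/2]. But if [Z(x + 1) <= Z(x) / K] and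
    [Z(x - 1) < K Z(x)], the negative part of [M(x)] is at most of order
    [K `^ (al - 1) N `^ (1 - al)] and the positive part at least of order
    [K `^ (- al) N `^ (1 - al)], so for [K] large [M(x)] is that big. Hence an unbalanced pair
    [K Z(a + 1) <= Z(a)] with [Z(a) >= N0] propagates, [Z(a - j)] growing with [j], until some
    [M(a - j)] deviates, which it must as only finitely many sites have been visited. So such a
    pair ever occurs with probability at most [eta(N0)], uniformly in [a], and [eta(N0)] tends
    to 0.

    Dichotomy: if [a] is visited infinitely often but [a + 1] is not, unbalanced pairs at [a]
    occur for every [N0]. With the mirror image, the set of sites visited infinitely often is
    a.s. empty or everything.

    Zero-one law: let the walk escape to the right with positive probability. Some finite history
    has conditional probability at least [rho > 0] never to come back below level 2; collapsing
    its excursions below 1, a translated copy can be run from any history ending at a fresh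
    maximum [x] with [Z(x - 1) < N0], at a cost bounded below. Thus every such history has a
    uniformly positive chance of being transient, and a contraction argument shows that recurrence
    with infinitely many such histories is null. Finally, [Z(x - 1) >= N0 >= K] at the first visit
    to [x] is an unbalanced pair at [x - 1], hence of probability at most [eta(N0)]. *)

(** * Path functionals *)

Lemma rcons_ne0 {A : eqType} (s : seq A) (y : A) : rcons s y != [::].
Proof. by case: s. Qed.

Lemma history_ind (Q : seq int -> Prop) :
  (forall x, Q [:: x]) ->
  (forall s y, s != [::] -> Q s -> Q (rcons s y)) ->
  forall s, s != [::] -> Q s.
Proof.
move=> Q1 Qr; elim/last_ind => // s y IH _.
by have [->|s0] := eqVneq s [::]; [exact: Q1 | apply: Qr => //; exact: IH].
Qed.

Lemma loc_time_rcons (s : seq int) (y z : int) :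
  loc_time (rcons s y) z = (loc_time s z + (y == z))%N.
Proof. by rewrite /loc_time -cats1 count_cat /= addn0. Qed.

Lemma loc_time1 (x z : int) : loc_time [:: x] z = (x == z).
Proof. by rewrite /loc_time /= addn0. Qed.

Definition nbr (a b : int) : bool := (b == a + 1) || (b == a - 1).

Definition walk (s : seq int) : bool := sorted nbr s.

Lemma walk_rcons (s : seq int) (y : int) : s != [::] ->
  walk (rcons s y) = walk s && nbr (last 0 s) y.
Proof. by case: s => // a s _; rewrite /walk /= rcons_path. Qed.

Section Functionals.
Variable R : realType.
Implicit Types (s : seq int) (f : seq int -> int -> R).

(** Additive functional of a history: [f] receives the whole prefix before each jump, since the
    increments depend on the local times at that moment. *)
Definition acc f s : R := \sum_(i < (size s).-1) f (take i.+1 s) (nth 0 s i.+1).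

Lemma acc1 f (x : int) : acc f [:: x] = 0.
Proof. by rewrite /acc big_ord0. Qed.

Lemma acc_rcons f s y : s != [::] -> acc f (rcons s y) = acc f s + f s y.
Proof.
case: s => // a s _; rewrite /acc size_rcons /= big_ord_recr /=; congr (_ + _).
  apply: eq_bigr => i _; rewrite -!cats1 take_cat nth_cat.
  case: ltnP => [//|]; have := ltn_ord i; lia.
by rewrite nth_rcons ltnn eqxx -cats1 take_size_cat.
Qed.

Variable w : nat -> R.

Definition push_left (x : int) s (y : int) : R :=
  if (last 0 s == x) && (y == x - 1) then (w (loc_time s (x - 1)))^-1 else 0.

Definition push_right (x : int) s (y : int) : R :=
  if (last 0 s == x) && (y == x + 1) then (w (loc_time s (x + 1)))^-1 else 0.

(** [acc (pull x)] is the martingale $M(x)$: a jump from [x] has probability proportional to the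
    weight whose reciprocal it contributes, so the two signed contributions cancel in mean. *)
Definition pull (x : int) s (y : int) : R := push_left x s y - push_right x s y.

Definition left_moves (x : int) s : R :=
  acc (fun s y => ((last 0 s == x) && (y == x - 1))%:R) s.

Definition departures (x : int) s : R := acc (fun s _ => (last 0 s == x)%:R) s.

Lemma acc_pull x s : s != [::] ->
  acc (pull x) s = acc (push_left x) s - acc (push_right x) s.
Proof.
move: s; apply: history_ind => [y|s y s0 IH]; first by rewrite !acc1 subr0.
by rewrite !acc_rcons // IH /pull; ring.
Qed.

Lemma departuresE x s : s != [::] ->
  departures x s + (last 0 s == x)%:R = (loc_time s x)%:R.
Proof.
move: s; apply: history_ind => [y|s y s0 IH].
  by rewrite /departures acc1 add0r loc_time1.
by rewrite /departures acc_rcons // -/(departures x s) IH loc_time_rcons last_rcons natrD.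
Qed.

(** Every visit to [x] is the current one or ends with a jump left or right, and each jump right
    creates a visit to [x + 1]. *)
Lemma loc_time_le_moves x s : s != [::] -> walk s ->
  (loc_time s x)%:R <= (last 0 s == x)%:R + left_moves x s + (loc_time s (x + 1))%:R.
Proof.
move: s; apply: history_ind => [y _|s y s0 IH].
  rewrite /left_moves acc1 !loc_time1 addr0 lerDl ler0n //.
rewrite walk_rcons // => /andP[/IH {}IH nb].
rewrite /left_moves acc_rcons // -/(left_moves x s) !loc_time_rcons last_rcons !natrD.
have [ls|ls] := eqVneq (last 0 s) x; last first.
  rewrite (negbTE ls) in IH; move: IH => /=.
  by have [_|_] := eqVneq y x; have [_|_] := eqVneq y (x + 1); rewrite /=; lra.
rewrite ls eqxx in IH nb *; move: IH => /=.
have [e1 e2 e3] : [/\ (x + 1 == x) = false, (x + 1 == x - 1) = false & (x - 1 == x) = false].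
  by split; apply/eqP; lia.
have e4 : (x - 1 == x + 1) = false by rewrite eq_sym.
by case/orP: nb => /eqP ->; rewrite eqxx ?e1 ?e2 ?e3 ?e4 /=; lra.
Qed.

Hypothesis w_gt0 : forall k, 0 < w k.

(** Successive jumps to [x + 1] see strictly increasing local times there, so each index [k] is used
    at most once. *)
Lemma acc_push_right_le x s : s != [::] ->
  acc (push_right x) s <= \sum_(k < loc_time s (x + 1)) (w k)^-1.
Proof.
move: s; apply: history_ind => [y|s y s0 IH].
  by rewrite acc1 sumr_ge0 // => k _; rewrite invr_ge0 ltW.
rewrite acc_rcons // loc_time_rcons /push_right.
have [_|_] := eqVneq y (x + 1); last by rewrite andbF addr0 addn0.
rewrite addn1 big_ord_recr /= andbT lerD //.
by case: ifP => // _; rewrite invr_ge0 ltW.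
Qed.

Lemma acc_push_left_ge x s (m : nat) (b : R) : s != [::] ->
  (forall k, (k < m)%N -> b <= (w k)^-1) -> (loc_time s (x - 1) <= m)%N ->
  b * left_moves x s <= acc (push_left x) s.
Proof.
move=> + bm; move: s; apply: history_ind => [y|s y s0 IH].
  by rewrite /left_moves !acc1 mulr0.
rewrite /left_moves !acc_rcons // -/(left_moves x s) loc_time_rcons => le_m.
rewrite mulrDr lerD //; first by apply: IH; lia.
rewrite /push_left; case: ifP => [/andP[_ /eqP yx]|_]; last by rewrite mulr0.
(* The jump itself adds a visit to [x - 1], so the local time it sees is strictly below [m]. *)
by rewrite mulr1 bm //; move: le_m; rewrite yx eqxx addn1.
Qed.

End Functionals.

(** * Growth of local times *)

Section Reals.
Variable R : realType.

Lemma sum_inv_powR_le (al : R) (m : nat) : 0 <= al -> al <= 2^-1 ->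
  \sum_(k < m) (k.+1%:R `^ al)^-1 <= 2 * m%:R `^ (1 - al).
Proof.
move=> al0 al2; elim: m => [|m IH]; first by rewrite big_ord0 mulr_ge0 ?powR_ge0.
rewrite big_ord_recr /=; apply: le_trans (lerD IH (lexx _)) _.
have q0 : 0 < m.+1%:R :> R by rewrite ltr0n.
have pq0 : 0 < m.+1%:R `^ al :> R by rewrite powR_gt0.
have eqq : forall n, n.+1%:R `^ (1 - al) = n.+1%:R / n.+1%:R `^ al :> R.
  move=> n; rewrite powRB ?powRr1 //.
  by apply/implyP => _; rewrite pnatr_eq0.
rewrite eqq; case: m => [|m] in q0 pq0 IH *.
  by rewrite powR0 ?powR1 ?mulr0 ?add0r //; [lra | apply/eqP; lra].
rewrite eqq.
have p0 : 0 < m.+1%:R :> R by rewrite ltr0n.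
have pp0 : 0 < m.+1%:R `^ al :> R by rewrite powR_gt0.
(* With $p = m + 1$ the induction step reduces to $((p+1)/p)^\alpha \le 1 + 1/(2p)$, which follows
   from $\alpha \le 1/2$ and $\sqrt{1+v} \le 1 + v/2$. *)
have ratio : m.+2%:R `^ al / m.+1%:R `^ al <= 1 + (2 * m.+1%:R)^-1 :> R.
  rewrite ler_pdivrMr //.
  have -> : m.+2%:R = (m.+2%:R / m.+1%:R) * m.+1%:R :> R by rewrite divfK // gt_eqF.
  rewrite powRM ?divr_ge0 // ler_wpM2r ?powR_ge0 //.
  have r1 : 1 <= m.+2%:R / m.+1%:R :> R by rewrite ler_pdivlMr // mul1r ler_nat.
  apply: (le_trans (ler_powR r1 al2)); rewrite powR12_sqrt; last exact: le_trans ler01 r1.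
  have h0 : 0 <= 1 + (2 * m.+1%:R)^-1 :> R by rewrite addr_ge0 // invr_ge0 mulr_ge0.
  rewrite -[leRHS](ger0_norm h0) -sqrtr_sqr ler_wsqrtr //.
  have -> : m.+2%:R = m.+1%:R + 1 :> R by rewrite -[in LHS]addn1 natrD.
  rewrite mulrDl divff ?gt_eqF // mul1r sqrrD expr1n mul1r invfM -lerBlDr.
  have := sqr_ge0 (2^-1 * m.+1%:R^-1 : R); move: (m.+1%:R^-1) => v; nra.
rewrite ler_pdivrMr // in ratio.
set q := m.+2%:R `^ al in pq0 ratio *; set u := m.+1%:R `^ al in pp0 ratio *.
have -> : m.+2%:R = m.+1%:R + 1 :> R by rewrite -[in LHS]addn1 natrD.
set p := m.+1%:R in p0 ratio *; clearbody p q u.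
have ratio2 : 2 * p * q <= (2 * p + 1) * u.
  have -> : (2 * p + 1) * u = 2 * p * ((1 + (2 * p)^-1) * u) by field; rewrite gt_eqF.
  by rewrite ler_wpM2l // mulr_ge0 // ltW.
have -> : 2 * (p / u) + q^-1 = (2 * p * q + u) / (u * q) by field; rewrite !gt_eqF.
have -> : 2 * ((p + 1) / q) = (2 * p * u + 2 * u) / (u * q) by field; rewrite !gt_eqF.
by rewrite ler_wpM2r ?invr_ge0 ?mulr_ge0 ?(ltW pq0) ?(ltW pp0) //; lra.
Qed.

(* Since [al < 1 - al], a large [K] makes [K `^ - al] beat any multiple of
   [K `^ (al - 1)]. *)
Lemma exists_ratio (al A B : R) : al < 2^-1 -> 0 < A ->
  exists2 K : nat, (2 <= K)%N & B * K%:R `^ (al - 1) <= A * K%:R `^ (- al).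
Proof.
move=> al2 A0.
have d0 : 0 < 1 - 2 * al by lra.
(* This solves $|B|/A \le K^{1-2\alpha}$ for $K$; multiplying by $K^{\alpha-1}$ gives the claim. *)
pose x := Num.max 2 ((`|B| / A) `^ (1 - 2 * al)^-1).
have [K xK] : exists K : nat, x <= K%:R.
  by exists (Num.bound x); apply/ltW/archi_boundP; rewrite le_max ler0n.
have [x2 xB] : 2 <= x /\ (`|B| / A) `^ (1 - 2 * al)^-1 <= x.
  by rewrite /x !le_max !lexx orbT.
have K2 : (2 <= K)%N by rewrite -(ler_nat R) (le_trans x2).
exists K => //; have K0 : 0 < K%:R :> R by rewrite ltr0n; lia.
have BK : `|B| / A <= K%:R `^ (1 - 2 * al).
  have -> : `|B| / A = ((`|B| / A) `^ (1 - 2 * al)^-1) `^ (1 - 2 * al).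
    rewrite -powRrM mulVf ?gt_eqF // powRr1 // divr_ge0 ?(ltW A0) //.
  by apply: ge0_ler_powR; rewrite ?nnegrE ?powR_ge0 ?(ltW d0) ?(ltW K0) // (le_trans xB).
have -> : - al = (1 - 2 * al) + (al - 1) by ring.
rewrite (powRD (r := 1 - 2 * al) (s := al - 1)); last by apply/implyP => _; rewrite gt_eqF.
rewrite mulrA ler_wpM2r ?powR_ge0 //.
rewrite (le_trans (ler_norm _)) //.
by move: BK; rewrite ler_pdivrMr // mulrC.
Qed.

End Reals.

Section Growth.
Variables (R : realType) (w : nat -> R) (al c C : R).
Hypotheses (al0 : 0 <= al) (al2 : al < 2^-1) (c0 : 0 < c) (C0 : 0 < C).
Hypothesis w_ge : forall k, c * k.+1%:R `^ al <= w k.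
Hypothesis w_le : forall k, w k <= C * k.+1%:R `^ al.

Lemma al_le1 : 0 <= 1 - al.
Proof. by have := al2; lra. Qed.

Lemma weight_gt0 k : 0 < w k.
Proof. by apply: lt_le_trans (w_ge k); rewrite mulr_gt0 // powR_gt0. Qed.

Lemma weight_ge k : c <= w k.
Proof.
apply: le_trans (w_ge k); rewrite ler_peMr ?(ltW c0) //.
by rewrite -[leLHS](powRr0 k.+1%:R) ler_powR // ler1n.
Qed.

Lemma site_growth : exists2 K : nat, (2 <= K)%N & exists2 e : R, 0 < e &
  forall s x, s != [::] -> walk s -> (4 <= loc_time s x)%N ->
    (K * loc_time s (x + 1) <= loc_time s x)%N ->
    (loc_time s (x - 1) < K * loc_time s x)%N ->
    e * (loc_time s x)%:R `^ (1 - al) <= acc (pull w x) s.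
Proof.
have A0 : 0 < (8 * C)^-1 by rewrite invr_gt0 mulr_gt0.
(* The right pushes total at most $(2/c) K^{\alpha-1} N^{1-\alpha}$ and the left ones at least
   $(4C)^{-1} K^{-\alpha} N^{1-\alpha}$; $K$ makes the former at most half of the latter, and the
   remaining half gives the constant [e]. *)
have [K K2 HK] := @exists_ratio R al (8 * C)^-1 (2 / c) al2 A0.
have K0 : 0 < K%:R :> R by rewrite ltr0n; lia.
exists K => //; exists ((8 * C)^-1 * K%:R `^ (- al)); first by rewrite mulr_gt0 ?powR_gt0.
move=> s x s0 ws N4 KN NK; rewrite acc_pull //.
set N := loc_time s x in N4 KN NK *.
have N00 : (0 < N)%N by exact: leq_trans N4.
have N0 : 0 < N%:R :> R by rewrite ltr0n.
have right_le : acc (push_right w x) s <= 2 / c * K%:R `^ (al - 1) * N%:R `^ (1 - al).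
  apply: le_trans (acc_push_right_le weight_gt0 x s0) _.
  set m := loc_time s (x + 1) in KN *.
  have H1 : \sum_(k < m) (w k)^-1 <= c^-1 * \sum_(k < m) (k.+1%:R `^ al)^-1.
    rewrite mulr_sumr ler_sum // => k _; rewrite -invfM lef_pV2 ?posrE ?weight_gt0 ?w_ge //.
    by rewrite mulr_gt0 // powR_gt0.
  apply: le_trans H1 _.
  have -> : 2 / c * K%:R `^ (al - 1) * N%:R `^ (1 - al) =
      c^-1 * (2 * (K%:R `^ (al - 1) * N%:R `^ (1 - al))) by ring.
  rewrite ler_wpM2l ?invr_ge0 ?(ltW c0) //.
  apply: le_trans (sum_inv_powR_le m al0 (ltW al2)) _.
  rewrite ler_wpM2l //.
  have -> : al - 1 = - (1 - al) by ring.
  rewrite powRN mulrC ler_pdivlMr ?powR_gt0 // -powRM ?ler0n //.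
  apply: ge0_ler_powR; rewrite ?nnegrE ?mulr_ge0 ?ler0n ?al_le1 //.
  by rewrite -natrM ler_nat mulnC.
have left_ge : (4 * C)^-1 * K%:R `^ (- al) * N%:R `^ (1 - al) <= acc (push_left w x) s.
  have KN0 : 0 < (K * N)%:R `^ al :> R by rewrite powR_gt0 // natrM mulr_gt0.
  pose b := (C * (K * N)%:R `^ al)^-1.
  have b0 : 0 <= b by rewrite invr_ge0 mulr_ge0 ?(ltW C0) ?(ltW KN0).
  apply: le_trans (acc_push_left_ge s0 (m := (K * N)%N) (b := b) _ _); last 2 first.
  - move=> k kK; rewrite /b lef_pV2 ?posrE ?weight_gt0 ?mulr_gt0 //.
    apply: le_trans (w_le k) _; rewrite ler_wpM2l ?(ltW C0) //.
    by apply: ge0_ler_powR; rewrite ?nnegrE ?ler0n // ler_nat.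
  - exact: ltnW.
  (* Jumps right account for at most [N / 2] visits since [2 <= K], and the current visit for at
     most [N / 4] since [4 <= N]. *)
  have moves : 4^-1 * N%:R <= left_moves R x s.
    have := loc_time_le_moves R x s0 ws; rewrite -/N.
    have : (last 0 s == x)%:R <= 1 :> R by case: (_ == _).
    have : 2 * (loc_time s (x + 1))%:R <= N%:R :> R.
      by rewrite -natrM ler_nat (leq_trans _ KN) // leq_mul2r K2 orbT.
    have : 4 <= N%:R :> R by rewrite ler_nat.
    lra.
  apply: le_trans (ler_wpM2l b0 moves).
  rewrite /b natrM powRM ?ler0n // powRB; last by apply/implyP => _; rewrite gt_eqF.
  rewrite powRr1 ?ler0n // powRN le_eqVlt; apply/orP; left; apply/eqP.
  by field; rewrite !gt_eqF ?powR_gt0.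
have HKN := ler_wpM2r (powR_ge0 N%:R (1 - al)) HK.
move: HKN right_le left_ge; rewrite -!mulrA.
set U := K%:R `^ (- al) * _; set V := K%:R `^ (al - 1) * _.
have -> : (4 * C)^-1 * U = 2 * ((8 * C)^-1 * U) by field; rewrite gt_eqF.
lra.
Qed.

(** Without a deviation, [site_growth] forces the unbalance one site further left, with a strictly
    larger local time each time; a finite history cannot sustain this. Bounding [j] by the local
    time leaves only $N + 1$ candidate sites for each value $N$. *)
Lemma leftward_growth : exists2 e : R, 0 < e & exists K : nat,
  forall (N0 : nat) s a, s != [::] -> walk s -> (4 <= N0)%N ->
    (N0 <= loc_time s a)%N -> (K * loc_time s (a + 1) <= loc_time s a)%N ->
    exists j : nat, [/\ (N0 <= loc_time s (a - j%:Z))%N, (j <= loc_time s (a - j%:Z))%N &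
      e * (loc_time s (a - j%:Z))%:R `^ (1 - al) <= acc (pull w (a - j%:Z)) s].
Proof.
have [K K2 [e e0 He]] := site_growth.
exists e => //; exists K => N0 s a s0 ws N4 Na Ka; apply: contrapT => nobad.
have grow : forall j : nat, (N0 + j <= loc_time s (a - j%:Z))%N /\
    (K * loc_time s (a - j%:Z + 1) <= loc_time s (a - j%:Z))%N.
  elim=> [|j [IH1 IH2]]; first by rewrite subr0 addn0.
  have -> : a - j.+1%:Z = a - j%:Z - 1 by lia.
  rewrite subrK.
  suff : (K * loc_time s (a - j%:Z) <= loc_time s (a - j%:Z - 1))%N.
    by move=> H; split => //; nia.
  rewrite leqNgt; apply/negP => lt; apply: nobad; exists j; split; [lia|lia|].
  by apply: He => //; lia.
have [h _] := grow (size s).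
have := leq_trans h (count_size _ s).
by rewrite -[leqRHS]add0n leq_add2r leqn0 => /eqP N00; move: N4; rewrite N00.
Qed.

End Growth.

(** * Hitting probabilities and the deviation bound *)

Section Hitting.
Variables (R : realType) (w : nat -> R).
Hypothesis w_gt0 : forall k, 0 < w k.
Implicit Types (s : seq int) (B : seq int -> bool).

Local Notation step := (vrrw_step w).

Lemma step_right s : step s (last 0 s + 1) =
  w (loc_time s (last 0 s + 1)) /
    (w (loc_time s (last 0 s - 1)) + w (loc_time s (last 0 s + 1))).
Proof. by rewrite /vrrw_step eqxx. Qed.

Lemma step_left s : step s (last 0 s - 1) =
  w (loc_time s (last 0 s - 1)) /
    (w (loc_time s (last 0 s - 1)) + w (loc_time s (last 0 s + 1))).
Proof.
rewrite /vrrw_step eqxx; case: eqP => // H.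
by have : last 0 s - 1 <> last 0 s + 1 by lia.
Qed.

Lemma step_sum s : step s (last 0 s + 1) + step s (last 0 s - 1) = 1.
Proof.
rewrite step_right step_left -mulrDl addrC divff // gt_eqF // addr_gt0 //.
Qed.

Lemma step_ge0 s y : 0 <= step s y.
Proof.
by rewrite /vrrw_step; do 2?case: ifP => // _; rewrite divr_ge0 ?addr_ge0 ?ltW.
Qed.

(** Probability of meeting [B] within [H] further steps, computed from the transition kernel alone,
    so that bounds and translations need no probability space. *)
Fixpoint hitp B (H : nat) s : R :=
  if B s then 1 else if H is H'.+1 then
    step s (last 0 s + 1) * hitp B H' (rcons s (last 0 s + 1)) +
    step s (last 0 s - 1) * hitp B H' (rcons s (last 0 s - 1))
  else 0.

Lemma hitp_bad B H s : B s -> hitp B H s = 1.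
Proof. by case: H => [|H] /= ->. Qed.

(** Maximal inequality for a nonnegative supermartingale, by induction on the horizon. The length
    cap [L] allows [Lam] to be a finite sum over local times. *)
Lemma hitp_le_super B (Lam : seq int -> R) (L : nat) :
  (forall s, 0 <= Lam s) ->
  (forall s, B s -> (size s <= L)%N -> 1 <= Lam s) ->
  (forall s, s != [::] -> step s (last 0 s + 1) * Lam (rcons s (last 0 s + 1)) +
    step s (last 0 s - 1) * Lam (rcons s (last 0 s - 1)) <= Lam s) ->
  forall H s, s != [::] -> (size s + H <= L)%N -> hitp B H s <= Lam s.
Proof.
move=> L0 LB LS; elim=> [|H IH] s s0 sL /=; case: ifP => Bs; rewrite ?L0 ?LB //; try lia.
apply: le_trans (LS s s0); apply: lerD; apply: ler_wpM2l; rewrite ?step_ge0 //;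
  by apply: IH; rewrite ?rcons_ne0 // size_rcons; lia.
Qed.

Lemma hitp_ge0 B H s : 0 <= hitp B H s.
Proof.
by elim: H s => [|H IH] s /=; case: ifP => // _; rewrite addr_ge0 // mulr_ge0 // step_ge0.
Qed.

Lemma hitp_le1 B H s : s != [::] -> hitp B H s <= 1.
Proof.
move=> s0; apply: (@hitp_le_super B (fun=> 1) (size s + H)) => // t _.
by rewrite !mulr1 step_sum.
Qed.

(** Strictly above [m], transitions consult only local times at sites from [m] on, and these agree
    up to the translation by [a]. *)
Lemma hitp_shift (m a : int) H s s' : s != [::] -> s' != [::] ->
  last 0 s' = last 0 s + a ->
  (forall y, m <= y -> loc_time s' (y + a) = loc_time s y) ->
  hitp (fun t => last 0 t <= m + a) H s' = hitp (fun t => last 0 t <= m) H s.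
Proof.
elim: H s s' => [|H IH] s s' s0 s'0 la lo /=; rewrite la lerD2r //.
case: ifPn => //; rewrite -ltNge => ml.
have m1 : m <= last 0 s - 1 by lia.
have m2 : m <= last 0 s + 1 by lia.
have e1 : last 0 s + a + 1 = last 0 s + 1 + a by lia.
have e2 : last 0 s + a - 1 = last 0 s - 1 + a by lia.
have st1 : step s' (last 0 s + a + 1) = step s (last 0 s + 1).
  by rewrite -{1}la !step_right la e1 e2 !lo.
have st2 : step s' (last 0 s + a - 1) = step s (last 0 s - 1).
  by rewrite -{1}la !step_left la e1 e2 !lo.
rewrite st1 st2 e1 e2; congr (_ * _ + _ * _); apply: IH; rewrite ?rcons_ne0 ?last_rcons //;
  by move=> y my; rewrite !loc_time_rcons lo // (inj_eq (addIr a)).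
Qed.

End Hitting.

(** * Exponential supermartingales *)

Section Supermartingale.
Variables (R : realType) (w : nat -> R) (c : R).
Hypotheses (c0 : 0 < c) (w_ge : forall k, c <= w k).
Let w_gt0 k : 0 < w k := lt_le_trans c0 (w_ge k).

(** Follows from [expR u <= (1 - u)^-1], since $(1-u)(1+u+2u^2) = 1 + u^2(1-2u)$. *)
Lemma expR_le_quadratic (u : R) : u <= 2^-1 -> expR u <= 1 + u + 2 * u ^+ 2.
Proof.
move=> u2; have e : 1 - u <= expR (- u) by have := expR_ge1Dx (- u).
have u0 : 0 < 1 - u by lra.
apply: (@le_trans _ _ (1 - u)^-1).
  by rewrite -[leLHS]invrK -expRN lef_pV2 // ?posrE ?expR_gt0.
rewrite -[leLHS]mul1r ler_pdivrMr //; nra.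
Qed.

Definition tilt (x : int) (l : R) (s : seq int) : R :=
  expR (l * acc (pull w x) s - 2 * (l / c) ^+ 2 * departures R x s).

(** The first-order terms of the two exponentials cancel because $M(x)$ is a martingale; the
    second-order terms are at most $2(l/c)^2$, and the departure from [x] pays for them. *)
Lemma tilt_super (x : int) (l : R) (s : seq int) : 0 <= l -> l / c <= 2^-1 -> s != [::] ->
  vrrw_step w s (last 0 s + 1) * tilt x l (rcons s (last 0 s + 1)) +
  vrrw_step w s (last 0 s - 1) * tilt x l (rcons s (last 0 s - 1)) <= tilt x l s.
Proof.
move=> l0 lc s0.
have tiltE y : tilt x l (rcons s y) =
    tilt x l s * expR (l * pull w x s y - 2 * (l / c) ^+ 2 * (last 0 s == x)%:R).
  rewrite /tilt /departures !acc_rcons // -expRD; congr expR; ring.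
rewrite !tiltE !(mulrCA _ (tilt x l s)) -mulrDr ler_piMr ?expR_ge0 //.
have [lx|lx] := eqVneq (last 0 s) x; last first.
  by rewrite /pull /push_left /push_right (negbTE lx) /= subr0 !mulr0 subr0 expR0 !mulr1 step_sum.
have n1 : (last 0 s + 1 == last 0 s - 1) = false by apply/eqP; lia.
have n2 : (last 0 s - 1 == last 0 s + 1) = false by rewrite eq_sym.
rewrite /pull /push_left /push_right -lx !eqxx n1 n2 /= sub0r subr0 mulr1 step_right step_left.
set wl := w (loc_time s (last 0 s - 1)); set wr := w (loc_time s (last 0 s + 1)).
have wl0 : 0 < wl by exact: w_gt0.
have wr0 : 0 < wr by exact: w_gt0.
have wlc : l / wl <= l / c by rewrite ler_wpM2l // lef_pV2 ?posrE ?w_ge.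
have wrc : l / wr <= l / c by rewrite ler_wpM2l // lef_pV2 ?posrE ?w_ge.
have p1 : 0 <= l / wl by rewrite divr_ge0 // ltW.
have p2 : 0 <= l / wr by rewrite divr_ge0 // ltW.
rewrite !expRD !mulrA -mulrDl expRN ler_pdivrMr ?expR_gt0 // mul1r.
apply: le_trans (expR_ge1Dx _).
have E1 : expR (l * - wr^-1) <= 1 - l / wr + 2 * (l / c) ^+ 2.
  rewrite mulrN; apply: le_trans (expR_le_quadratic _) _; first lra.
  by rewrite sqrrN lerD2l ler_wpM2l // ler_sqr ?nnegrE //; lra.
have E2 : expR (l * wl^-1) <= 1 + l / wl + 2 * (l / c) ^+ 2.
  apply: le_trans (expR_le_quadratic _) _; first lra.
  by rewrite lerD2l ler_wpM2l // ler_sqr ?nnegrE //; lra.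
have q1 : 0 <= wr / (wl + wr) by rewrite divr_ge0 ?addr_ge0 ?ltW.
have q2 : 0 <= wl / (wl + wr) by rewrite divr_ge0 ?addr_ge0 ?ltW.
apply: le_trans (lerD (ler_wpM2l q1 E1) (ler_wpM2l q2 E2)) _.
rewrite le_eqVlt; apply/orP; left; apply/eqP; field.
by rewrite !gt_eqF // addr_gt0.
Qed.

End Supermartingale.

(** * Stretched-exponential tails *)

Section Tail.
Variable R : realType.

(** With $t = e N^d$ and $k + 1 \ge 3/d$, the inequality $\exp(t) \ge (t/(k+1))^{k+1}$ already
    yields a power of $N$ of order at least 3. *)
Lemma stretched_exp_le (e d : R) : 0 < e -> 0 < d -> exists2 Q : R, 0 < Q &
  forall N : nat, (0 < N)%N -> N%:R ^+ 3 * expR (- (e * N%:R `^ d)) <= Q.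
Proof.
move=> e0 d0.
have [k dk] : exists k : nat, 3 / d <= k.+1%:R.
  exists (Num.bound (3 / d)); apply: (@le_trans _ _ (Num.bound (3 / d))%:R); last by rewrite ler_nat.
  by apply/ltW/archi_boundP; rewrite divr_ge0 // ltW.
rewrite ler_pdivrMr // in dk.
exists ((k.+1%:R / e) ^+ k.+1); first by rewrite exprn_gt0 // divr_gt0.
move=> N N0; set t := e * _.
have N1 : 1 <= N%:R :> R by rewrite ler1n.
have t0 : 0 <= t by rewrite mulr_ge0 ?powR_ge0 // ltW.
rewrite expRN ler_pdivrMr ?expR_gt0 //.
have -> : expR t = expR (t / k.+1%:R) ^+ k.+1 by rewrite -expRM_natr divfK // pnatr_eq0.
rewrite -exprMn.
have H1 : N%:R `^ d <= k.+1%:R / e * expR (t / k.+1%:R).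
  apply: (@le_trans _ _ (k.+1%:R / e * (t / k.+1%:R))).
    have K0 : k.+1%:R != 0 :> R by rewrite pnatr_eq0.
    rewrite /t le_eqVlt; apply/orP; left; apply/eqP.
    by move: (k.+1%:R) K0 => K K0; field; rewrite K0 gt_eqF.
  rewrite ler_wpM2l ?divr_ge0 ?(ltW e0) //.
  by apply: le_trans (expR_ge1Dx _); rewrite lerDr.
apply: (@le_trans _ _ ((N%:R `^ d) ^+ k.+1)); last first.
  by apply: lerXn2r; rewrite ?nnegrE ?powR_ge0 // (le_trans (powR_ge0 _ _) H1).
rewrite -!powR_mulrn ?powR_ge0 ?ler0n // -powRrM ler_powR // mulrC.
by rewrite (le_trans dk) // mulrC.
Qed.

(** The factor [N.+1] counts the sites [a - j] with [j <= N]. The cubic bound dominates each term by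
    $Q'/(N(N+1))$, and these telescope. *)
Lemma small_tail (A e d eta : R) (n1 : nat) : 0 < A -> 0 < e -> 0 < d -> 0 < eta ->
  exists2 N0 : nat, (n1 < N0)%N & forall H,
    \sum_(N0 <= N < H) N.+1%:R * (A * expR (- (e * N%:R `^ d))) <= eta.
Proof.
move=> A0 e0 d0 eta0; have [Q Q0 HQ] := stretched_exp_le e0 d0.
pose Q' := 4 * A * Q.
have Q'0 : 0 < Q' by rewrite !mulr_gt0.
pose n2 := Num.bound (Q' / eta).
have b2 : Q' / eta < n2%:R by apply: archi_boundP; rewrite divr_ge0 // ltW.
exists (n1 + n2).+1; first by lia.
set N0 := (n1 + n2).+1 => H.
have key : forall m, \sum_(N0 <= N < N0 + m) N.+1%:R * (A * expR (- (e * N%:R `^ d))) <=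
    Q' / N0%:R - Q' / (N0 + m)%:R.
  elim=> [|m IH]; first by rewrite addn0 big_geq // subrr.
  rewrite addnS big_nat_recr ?leq_addr //=.
  apply: le_trans (lerD IH (lexx _)) _.
  set N := (N0 + m)%N.
  have N1 : 1 <= N%:R :> R by rewrite ler1n.
  have := HQ N (isT : 0 < N)%N; set E := expR _ => HE.
  have E0 : 0 < E by rewrite expR_gt0.
  have -> : N.+1%:R = N%:R + 1 :> R by rewrite -[in LHS]addn1 natrD.
  set p := N%:R in HE N1 *; clearbody E p.
  suff : (p + 1) * (A * E) <= Q' / p - Q' / (p + 1) by lra.
  have -> : Q' / p - Q' / (p + 1) = Q' / (p * (p + 1)).
    by field; apply/andP; split; rewrite gt_eqF //; lra.
  rewrite ler_pdivlMr; last by rewrite mulr_gt0 //; lra.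
  have -> : (p + 1) * (A * E) * (p * (p + 1)) = A * E * (p * (p + 1) ^+ 2) by ring.
  have : p * (p + 1) ^+ 2 <= 4 * p ^+ 3 by nra.
  have AE0 : 0 <= A * E by rewrite mulr_ge0 ?ltW.
  move=> /(ler_wpM2l AE0) h; apply: (le_trans h).
  have -> : A * E * (4 * p ^+ 3) = 4 * A * (p ^+ 3 * E) by ring.
  by rewrite /Q' ler_wpM2l // mulr_ge0 // ltW.
have [HN|HN] := leqP H N0; first by rewrite big_geq // ltW.
rewrite -(subnKC (ltnW HN)); apply: le_trans (key _) _.
apply: (@le_trans _ _ (Q' / N0%:R)); first by rewrite gerBl divr_ge0 // ltW.
rewrite ler_pdivrMr ?ltr0n // mulrC -ler_pdivrMr // (le_trans (ltW b2)) // ler_nat.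
by rewrite /N0; lia.
Qed.

End Tail.

Section Deviation.
Variables (R : realType) (w : nat -> R) (al c e : R).
Hypotheses (al2 : al < 2^-1) (c0 : 0 < c) (e0 : 0 < e).
Hypothesis w_ge : forall k, c <= w k.

Definition deviates (N0 : nat) (a : int) (s : seq int) : bool :=
  `[< exists j : nat, [/\ (N0 <= loc_time s (a - j%:Z))%N, (j <= loc_time s (a - j%:Z))%N &
      e * (loc_time s (a - j%:Z))%:R `^ (1 - al) <= acc (pull w (a - j%:Z)) s] >].

(* Exponential martingales tilted by [N `^ - 2^-1] for every local time [N] and every site
   [a - j], summed so that a single maximal inequality controls all deviations at once. *)
Lemma hitp_deviates_le (eta : R) (n1 : nat) : 0 < eta ->
  exists2 N0 : nat, (n1 < N0)%N & forall a H, hitp w (deviates N0 a) H [:: 0] <= eta.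
Proof.
move=> eta0.
(* With tilt $l = N^{-1/2}$ and at most $N$ departures the compensator in [tilt] is at most $2/c^2$;
   [kap] cancels it. *)
pose kap := expR (2 * c^-1 ^+ 2).
have k0 : 0 < kap by rewrite expR_gt0.
have d0 : 0 < 2^-1 - al by have := al2; lra.
(* Beyond $4/c^2$ the tilt satisfies $l/c \le 1/2$, as [tilt_super] requires. *)
pose n2 := Num.bound (4 / c ^+ 2).
have b2 : 4 / c ^+ 2 < n2%:R by apply: archi_boundP; rewrite divr_ge0 // sqr_ge0.
have [N0 N01 HN0] := small_tail (n1 + n2) k0 e0 d0 eta0.
exists N0; first by lia.
move=> a H.
pose l (N : nat) : R := (Num.sqrt N%:R)^-1.
(* Histories of length at most [H + 1] have local times below [H + 2]. Each coefficient makes its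
   term at least 1 once the corresponding deviation occurs. *)
pose Lam s : R := \sum_(N0 <= N < H.+2) \sum_(j < N.+1)
  kap * expR (- (e * N%:R `^ (2^-1 - al))) * tilt w c (a - j%:Z) (l N) s.
have pos N : (N0 <= N)%N -> (0 < N)%N by apply: leq_trans; exact: leq_ltn_trans N01.
have sq0 N : (N0 <= N)%N -> 0 < Num.sqrt N%:R :> R.
  by move=> /pos; rewrite sqrtr_gt0 ltr0n.
have kap_tilt N x s : 0 <= kap * expR (- (e * N%:R `^ (2^-1 - al))) * tilt w c x (l N) s.
  by rewrite !mulr_ge0 ?expR_ge0.
apply: le_trans (@hitp_le_super R w (fun k => lt_le_trans c0 (w_ge k)) (deviates N0 a)
  Lam H.+1 _ _ _ H [:: 0] _ _) _ => //.
- by move=> s; rewrite sumr_ge0 // => N _; rewrite sumr_ge0.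
- move=> s /asboolP [j]; set N := loc_time s _ => -[NN jN dev] sH.
  have NH : (N < H.+2)%N by rewrite ltnS (leq_trans (count_size _ _)).
  have s0 : s != [::] by apply/eqP => s0; move: NN; rewrite /N s0 leqNgt (leq_ltn_trans _ N01).
  have Nin : N \in index_iota N0 H.+2 by rewrite mem_index_iota NN.
  rewrite /Lam (bigD1_seq N) ?iota_uniq //= -[leLHS]addr0 lerD //; last first.
    by rewrite sumr_ge0 // => i _; rewrite sumr_ge0.
  have jN' : (j < N.+1)%N by [].
  rewrite (bigD1 (Ordinal jN')) //= -[leLHS]addr0 lerD //; last by rewrite sumr_ge0.
  rewrite /kap /tilt -!expRD -[leLHS]expR0 ler_expR.
  have sN0 := sq0 N NN.
  have D : departures R (a - j%:Z) s <= N%:R.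
    by rewrite /N -departuresE // lerDl.
  have sqN : Num.sqrt N%:R ^+ 2 = N%:R :> R by rewrite sqr_sqrtr.
  have lD : (l N / c) ^+ 2 * departures R (a - j%:Z) s <= c^-1 ^+ 2.
    rewrite exprMn mulrAC ler_piMl ?sqr_ge0 //.
    by rewrite /l exprVn sqN mulrC ler_pdivrMr ?mul1r // ltr0n pos.
  have lM : e * N%:R `^ (2^-1 - al) <= l N * acc (pull w (a - j%:Z)) s.
    have -> : e * N%:R `^ (2^-1 - al) = l N * (e * N%:R `^ (1 - al)).
      rewrite /l -powR12_sqrt // -powRN.
      have -> : 2^-1 - al = (- 2^-1) + (1 - al) by field.
      rewrite [in LHS](powRD (r := - 2^-1) (s := 1 - al)) ?(mulrCA e) //.
      by apply/implyP => _; rewrite pnatr_eq0 -lt0n pos.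
    by rewrite ler_wpM2l // invr_ge0 ltW.
  move: lD lM; rewrite -mulrA; lra.
- move=> s s0; rewrite /Lam !mulr_sumr -big_split /= !big_nat ler_sum // => N /andP[NN _].
  rewrite !mulr_sumr -big_split /= ler_sum // => j _.
  rewrite !(mulrCA (vrrw_step _ _ _)) -mulrDr ler_wpM2l ?mulr_ge0 ?expR_ge0 //.
  have sN0 := sq0 N NN.
  apply: tilt_super => //; first by rewrite invr_ge0 ltW.
  have -> : 2^-1 = Num.sqrt (4^-1) :> R.
    have -> : 4^-1 = 2^-1 ^+ 2 :> R by field.
    by rewrite sqrtr_sqr ger0_norm.
  rewrite /l; have -> : c^-1 = Num.sqrt (c^-1 ^+ 2) by rewrite sqrtr_sqr ger0_norm // invr_ge0 ltW.
  rewrite -sqrtrV ?ler0n // -sqrtrM ?invr_ge0 ?ler0n // ler_wsqrtr // mulrC ler_pdivrMr; last first.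
    by rewrite ltr0n pos.
  have n2N : n2%:R <= N%:R :> R.
    by rewrite ler_nat (leq_trans _ NN) // (leq_trans _ (ltnW N01)) // leq_addl.
  by move: b2; rewrite exprVn; lra.
(* On [[:: 0]] every tilt equals 1, so [Lam] is the tail sum that [small_tail] controls. *)
apply: le_trans (HN0 H.+2); rewrite /Lam !big_nat ler_sum // => N _.
rewrite (eq_bigr (fun=> kap * expR (- (e * N%:R `^ (2^-1 - al))))); last first.
  by move=> j _; rewrite /tilt /departures !acc1 !mulr0 subr0 expR0 mulr1.
by rewrite sumr_const card_ord mulr_natl.
Qed.

End Deviation.

(** * The law of the walk on cylinders *)

Section RealProbability.
Variables (d : measure_display) (T : measurableType d) (R : realType) (P : probability T R).
Implicit Types A B : set T.

Definition fprob A : R := fine (P A).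

Lemma prE A : measurable A -> P A = (fprob A)%:E.
Proof. by move=> mA; rewrite fineK // fin_num_measure. Qed.

Lemma pr_ge0 A : 0 <= fprob A.
Proof. by rewrite fine_ge0. Qed.

Lemma pr_le A B : measurable A -> measurable B -> A `<=` B -> fprob A <= fprob B.
Proof.
by move=> mA mB AB; rewrite -lee_fin -!prE // le_measure // inE.
Qed.

Lemma pr_setU A B : measurable A -> measurable B -> [disjoint A & B] ->
  fprob (A `|` B) = fprob A + fprob B.
Proof.
move=> mA mB /disj_set2P AB; apply: EFin_inj.
by rewrite EFinD -!prE //; [exact: measureU | exact: measurableU].
Qed.

Lemma pr_setU_le A B : measurable A -> measurable B -> fprob (A `|` B) <= fprob A + fprob B.
Proof.
move=> mA mB; rewrite -lee_fin EFinD -!prE //; last exact: measurableU.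
exact: measureU2.
Qed.

Lemma pr_setC A : measurable A -> fprob (~` A) = 1 - fprob A.
Proof.
by move=> mA; apply: EFin_inj; rewrite EFinB -!prE //; [exact: probability_setC|exact: measurableC].
Qed.

Lemma pr_bigcup_le (F : nat -> set T) (c : R) : (forall n, measurable (F n)) ->
  (forall n, F n `<=` F n.+1) -> (forall n, fprob (F n) <= c) -> fprob (\bigcup_n F n) <= c.
Proof.
move=> mF nF Fc; rewrite -lee_fin -prE; last exact: bigcup_measurable.
have cv := @nondecreasing_cvg_mu _ _ _ P F mF (bigcup_measurable (fun k _ => mF k)) _.
have ndF : {homo F : n m / (n <= m)%N >-> (n <= m)%O}.
  by apply/nondecreasing_seqP => n; apply/subsetPset/nF.
have {}cv := cv ndF; rewrite -(cvg_lim _ cv) //.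
apply: lime_le; first by apply/cvg_ex; eexists; exact: cv.
by near=> n; rewrite /= prE // lee_fin.
Unshelve. all: by end_near.
Qed.

Lemma measurable_exists (I : countType) (F : I -> set T) :
  (forall i, measurable (F i)) -> measurable [set x | exists i, F i x].
Proof.
move=> mF; rewrite (_ : [set x | _] = \bigcup_i F i).
  exact: countable_bigcupT_measurable.
by apply/seteqP; split=> x [i]; exists i.
Qed.

Lemma measurable_forall (I : countType) (F : I -> set T) :
  (forall i, measurable (F i)) -> measurable [set x | forall i, F i x].
Proof.
move=> mF; rewrite (_ : [set x | _] = ~` [set x | exists i, (~` F i) x]).
  by apply: measurableC; apply: measurable_exists => i; exact: measurableC.
apply/seteqP; split=> x /= h; first by move=> [i]; apply; exact: h.
by move=> i; apply: contrapT => Fi; apply: h; exists i.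
Qed.

Lemma measurable_guard (Q : Prop) A : measurable A -> measurable [set x | Q /\ A x].
Proof.
move=> mA; have [q|q] := pselect Q.
  by rewrite (_ : [set x | _] = A) //; apply/seteqP; split=> x //= [].
by rewrite (_ : [set x | _] = set0) //; apply/seteqP; split=> x //= [].
Qed.

Lemma pr_exists_eq0 (I : countType) (F : I -> set T) : (forall i, measurable (F i)) ->
  (forall i, fprob (F i) = 0) -> fprob [set x | exists i, F i x] = 0.
Proof.
move=> mF F0; apply: EFin_inj; rewrite -prE; last exact: measurable_exists.
pose G k := if unpickle k is Some i then F i else set0.
have mG k : measurable (G k) by rewrite /G; case: unpickle.
suff : P.-negligible (\bigcup_k G k).
  move=> /negligibleP; rewrite (_ : \bigcup_k G k = [set x | exists i, F i x]).
    by apply; exact: measurable_exists.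
  apply/seteqP; split=> x.
    by move=> [k _]; rewrite /G; case: unpickle => // i; exists i.
  by move=> [i Fi]; exists (pickle i) => //; rewrite /G pickleK.
apply: negligible_bigcup => k; apply/negligibleP; [exact: mG|].
rewrite /G; case: unpickle => [i|]; last exact: measure0.
by have := prE (mF i); rewrite F0.
Qed.

Lemma pr_sub_eq0 A B : measurable A -> measurable B -> A `<=` B -> fprob B = 0 -> fprob A = 0.
Proof. by move=> mA mB AB B0; apply/eqP; rewrite eq_le pr_ge0 andbT -B0 pr_le. Qed.

End RealProbability.

(** * Random histories *)

Section History.
Variables (T : Type) (X : nat -> T -> int).
Local Notation path := (path_event X).
Implicit Types (s : seq int).

Definition hist (n : nat) (om : T) : seq int := mkseq (fun i => X i om) n.+1.

Lemma histS n om : hist n.+1 om = rcons (hist n om) (X n.+1 om).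
Proof. by rewrite /hist /mkseq -[n.+2]addn1 iotaD map_cat /= cats1. Qed.

Lemma size_hist n om : size (hist n om) = n.+1.
Proof. exact: size_mkseq. Qed.

Lemma nth_hist i n om : (i <= n)%N -> nth 0 (hist n om) i = X i om.
Proof. by move=> iN; rewrite nth_mkseq. Qed.

Lemma hist_ne0 n om : hist n om != [::].
Proof. by rewrite -size_eq0 size_hist. Qed.

Lemma last_hist n om : last 0 (hist n om) = X n om.
Proof. by case: n => [//|n]; rewrite histS last_rcons. Qed.

Lemma path_eventP s om : s != [::] -> path s om <-> hist (size s).-1 om = s.
Proof.
case: s => // x s _; split=> [h|e i iS].
  apply: (@eq_from_nth _ 0); rewrite size_hist // => i iS.
  by rewrite nth_mkseq // h.
by rewrite -e nth_mkseq.
Qed.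

Lemma path_hist n om : path (hist n om) om.
Proof. by apply/path_eventP; rewrite ?hist_ne0 // size_hist. Qed.

Lemma path_rcons s y om : path (rcons s y) om <-> path s om /\ X (size s) om = y.
Proof.
split=> [h|[h hy] i]; rewrite ?size_rcons.
  split=> [i iS|]; last by rewrite h ?size_rcons // nth_rcons ltnn eqxx.
  by rewrite h ?size_rcons ?leqW // nth_rcons iS.
by rewrite ltnS leq_eqVlt nth_rcons => /orP[/eqP->|iS]; rewrite ?ltnn ?eqxx // iS h.
Qed.

(** [is_vrrw] constrains only the law of [X], so nearest-neighbour paths from 0 are only almost
    sure; pathwise arguments are run on this event. *)
Definition walking : set T :=
  [set om | X 0%N om = 0 /\ forall n, nbr (X n om) (X n.+1 om)].

Lemma walk_hist om n : walking om -> walk (hist n om).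
Proof.
move=> [_ nb]; elim: n => [|n IH] //.
by rewrite histS walk_rcons ?hist_ne0 // IH last_hist nb.
Qed.

Lemma path_offspring s om : s != [::] -> path s om -> walking om ->
  path (rcons s (last 0 s + 1)) om \/ path (rcons s (last 0 s - 1)) om.
Proof.
move=> s0 sm [_ nb]; have e := (path_eventP om s0).1 sm.
have nz : (0 < size s)%N by rewrite lt0n size_eq0.
have := nb (size s).-1; rewrite prednK //.
rewrite (_ : X (size s).-1 om = last 0 s); last by rewrite -e last_hist size_hist.
by case/orP => /eqP h; [left|right]; apply/path_rcons.
Qed.

End History.

(** * Markov property along histories *)

Section Process.
Variables (d : measure_display) (T : measurableType d) (R : realType) (P : probability T R).
Variables (w : nat -> R) (X : nat -> T -> int).
Hypothesis w_gt0 : forall k, 0 < w k.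
Hypothesis vX : is_vrrw P w X.
Local Notation pr := (fprob P).
Local Notation step := (vrrw_step w).
Local Notation path := (path_event X).
Local Notation hist := (hist X).
Local Notation walking := (walking X).
Implicit Types (s : seq int) (B : seq int -> bool) (A : set T).

Lemma measurable_at n x : measurable [set om | X n om = x].
Proof. by case: vX. Qed.

Lemma measurable_path s : measurable (path s).
Proof.
apply: measurable_forall => i; case: (ltnP i (size s)) => iS.
  rewrite (_ : (fun _ => _) = [set om | X i om = nth 0 s i]); first exact: measurable_at.
  by apply/seteqP; split=> om /= h; [exact: h|].
by rewrite (_ : (fun _ => _) = setT) //; apply/seteqP; split.
Qed.

(** Histories are countably many words, so such an event is a countable union of cylinders. *)
Lemma measurable_hist (Q : seq int -> Prop) n : measurable [set om | Q (hist n om)].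
Proof.
rewrite (_ : [set om | _] = [set om | exists s, (Q s /\ size s = n.+1) /\ path s om]).
  apply: measurable_exists => s; apply: measurable_guard; exact: measurable_path.
apply/seteqP; split=> om /=.
  by move=> q; exists (hist n om); rewrite size_hist; do !split => //; exact: path_hist.
move=> [s [[q ss]]] /path_eventP.
by rewrite -size_eq0 ss /= => /(_ isT) ->.
Qed.

Lemma pr_rcons s y : s != [::] -> pr (path (rcons s y)) = pr (path s) * step s y.
Proof.
move=> s0; apply: EFin_inj; rewrite EFinM -!prE; [|exact: measurable_path..].
by case: vX => _ [_]; apply; rewrite size_eq0.
Qed.

Lemma measurable_walking : measurable walking.
Proof.
apply: measurableI; first exact: measurable_at.
apply: measurable_forall => n.
rewrite (_ : (fun _ => _) =
    [set om | (fun s => nbr (nth 0 s n) (nth 0 s n.+1)) (hist n.+1 om)]).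
  exact: (measurable_hist (fun s => nbr (nth 0 s n) (nth 0 s n.+1))).
by apply/funext => om; rewrite /mkset !nth_hist.
Qed.

Lemma pr_offspring s : s != [::] ->
  pr (path s) = pr (path (rcons s (last 0 s + 1))) + pr (path (rcons s (last 0 s - 1))).
Proof. by move=> s0; rewrite !pr_rcons // -mulrDr step_sum // mulr1. Qed.

Lemma disjoint_offspring s A A' :
  [disjoint path (rcons s (last 0 s + 1)) `&` A & path (rcons s (last 0 s - 1)) `&` A'].
Proof.
apply/disj_set2P/seteqP; split=> om //= [[/path_rcons[_ h] _] [/path_rcons[_]]].
by rewrite h; lia.
Qed.

(** The two neighbouring extensions of a history already carry its whole mass, so a stray next step
    is null; there are only countably many histories. *)
Lemma pr_walking : pr walking = 1.
Proof.
suff h : pr (~` walking) = 0.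
  by move: h; rewrite pr_setC; [lra | exact: measurable_walking].
have stray s : s != [::] -> pr (path s `&` [set om | ~~ nbr (last 0 s) (X (size s) om)]) = 0.
  move=> s0; set E := _ `&` _.
  pose c1 := path (rcons s (last 0 s + 1)); pose c2 := path (rcons s (last 0 s - 1)).
  have mE : measurable E.
    rewrite (_ : E = [set om | exists y, ~~ nbr (last 0 s) y /\ path (rcons s y) om]).
      by apply: measurable_exists => y; apply: measurable_guard; exact: measurable_path.
    apply/seteqP; split=> om.
      by move=> [sm nb]; exists (X (size s) om); split=> //; apply/path_rcons.
    by move=> [y [nb /path_rcons[sm ym]]]; split=> //=; rewrite ym.
  have mc1 : measurable c1 by exact: measurable_path.
  have mc2 : measurable c2 by exact: measurable_path.
  have dcc : [disjoint c1 & c2].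
    by have := disjoint_offspring s setT setT; rewrite !setIT.
  have dE : [disjoint E & c1 `|` c2].
    apply/disj_set2P/seteqP; split=> om //= [[_ nb]].
    by move=> [] /path_rcons[_ e]; move: nb; rewrite /= e /nbr eqxx ?orbT.
  have sub : E `|` (c1 `|` c2) `<=` path s by move=> om [[]|[]] // /path_rcons[].
  have := pr_le P (measurableU _ _ mE (measurableU _ _ mc1 mc2)) (measurable_path s) sub.
  rewrite pr_setU //; last exact: measurableU.
  by rewrite pr_setU // (pr_offspring s0) -/c1 -/c2; have := pr_ge0 P E; lra.
have m0 : measurable (~` [set om | X 0%N om = 0]) by apply: measurableC; exact: measurable_at.
have p0 : pr (~` [set om | X 0%N om = 0]) = 0.
  rewrite pr_setC; last exact: measurable_at.
  by rewrite {1}/fprob; case: vX => _ [-> _]; rewrite subrr.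
pose F (s : option (seq int)) : set T := if s is Some s then
  [set om | s != [::] /\ (path s `&` [set om | ~~ nbr (last 0 s) (X (size s) om)]) om]
  else ~` [set om | X 0%N om = 0].
have mF o : measurable (F o).
  case: o => [s|] //; apply: measurable_guard.
  apply: measurableI; first exact: measurable_path.
  rewrite (_ : [set om | _] =
      [set om | (fun t => ~~ nbr (last 0 s) (last 0 t)) (hist (size s) om)]).
    exact: (measurable_hist (fun t => ~~ nbr (last 0 s) (last 0 t))).
  by apply/funext => om; rewrite /mkset last_hist.
have F0 o : pr (F o) = 0.
  case: o => [s|] //; have [s0|s0] := eqVneq s [::].
    by rewrite /F s0 /= (_ : [set om | _] = set0) ?/fprob ?measure0 //; apply/seteqP; split=> om //= [].
  rewrite -[RHS](stray s s0); congr fprob; apply/seteqP; split=> om; first by case.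
  by move=> h; split.
apply: pr_sub_eq0 (pr_exists_eq0 mF F0); last 2 first.
- exact: measurable_exists.
- move=> om nV; apply: contrapT => nF; apply: nV; split.
    by apply: contrapT => x0; apply: nF; exists None.
  move=> n; apply: contrapT => nb; apply: nF; exists (Some (hist n om)).
  split; first exact: hist_ne0.
  split; first exact: path_hist.
  by rewrite /mkset last_hist size_hist; apply/negP.
- by apply: measurableC; exact: measurable_walking.
Qed.

(** A word of size $n + 1$ is the history up to time $n$, so [(size s).-1] is the time at which [s]
    ends. *)
Definition hits B (H : nat) s : set T :=
  [set om | exists j : nat, (j <= H)%N /\ B (hist ((size s).-1 + j) om)].

Lemma measurable_hits B H s : measurable (hits B H s).
Proof.
apply: measurable_exists => j; apply: measurable_guard.
exact: (measurable_hist (fun t => B t)).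
Qed.

(** Strong Markov property at the first time [B] is met, where the conditional probability of [A] is
    at most [th]; the recursion on the horizon replaces stopping times. *)
Lemma pr_hits_le A B (th : R) : measurable A -> A `<=` walking -> 0 <= th ->
  (forall s, s != [::] -> B s -> pr (path s `&` A) <= th * pr (path s)) ->
  forall H s, s != [::] ->
    pr (path s `&` A `&` hits B H s) <= th * hitp w B H s * pr (path s).
Proof.
move=> mA Aw th0 HB.
have m s H : measurable (path s `&` A `&` hits B H s).
  apply: measurableI (measurable_hits _ _ _); apply: measurableI => //; exact: measurable_path.
have bad H s : s != [::] -> B s ->
    pr (path s `&` A `&` hits B H s) <= th * hitp w B H s * pr (path s).
  move=> s0 Bs; rewrite hitp_bad // mulr1; apply: le_trans (HB s s0 Bs).
  by apply: pr_le => //; apply: measurableI => //; exact: measurable_path.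
elim=> [|H IH] s s0; have [/bad h|nB] := boolP (B s); try exact: h.
  rewrite /= (negbTE nB) mulr0 mul0r (_ : _ `&` _ = set0) /fprob ?measure0 //.
  apply/seteqP; split=> om //= [[/(path_eventP X om s0) e _] [j [j0]]].
  have -> : j = 0%N by lia.
  by rewrite addn0 e (negbTE nB).
rewrite /= (negbTE nB); set s1 := rcons s _; set s2 := rcons s (_ - 1).
have s10 : s1 != [::] by exact: rcons_ne0.
have s20 : s2 != [::] by exact: rcons_ne0.
have sub : path s `&` A `&` hits B H.+1 s `<=`
    (path s1 `&` A `&` hits B H s1) `|` (path s2 `&` A `&` hits B H s2).
  move=> om [[sm Am] [j [jH Bj]]].
  have nz : (0 < size s)%N by rewrite lt0n size_eq0.
  case: j => [|j] in jH Bj *.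
    by move: Bj; rewrite addn0 ((path_eventP X om s0).1 sm) (negbTE nB).
  have Bj' : B (hist (size s + j) om).
    by move: Bj; rewrite addnS -addSn prednK.
  by case: (path_offspring s0 sm (Aw _ Am)) => h; [left|right]; split=> //;
    exists j; rewrite size_rcons.
apply: le_trans (pr_le P (m _ _) (measurableU _ _ (m _ _) (m _ _)) sub) _.
apply: le_trans (pr_setU_le _ (m _ _) (m _ _)) _.
apply: le_trans (lerD (IH _ s10) (IH _ s20)) _.
by rewrite /s1 /s2 !pr_rcons // le_eqVlt; apply/orP; left; apply/eqP; ring.
Qed.

(** Avoiding [B] forever does not involve [H]; each unfolding of [hitp] passes this event on to the
    two extensions of [s]. *)
Lemma pr_avoids_le B H s : s != [::] ->
  pr (path s `&` walking `&` [set om | forall j, ~~ B (hist ((size s).-1 + j) om)]) <=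
    (1 - hitp w B H s) * pr (path s).
Proof.
pose av s := [set om | forall j, ~~ B (hist ((size s).-1 + j) om)].
rewrite -/(av s); have m s' : measurable (path s' `&` walking `&` av s').
  apply: measurableI; first by apply: measurableI; [exact: measurable_path|exact: measurable_walking].
  apply: measurable_forall => j; exact: (measurable_hist (fun t => ~~ B t)).
have bad s' (r : R) : s' != [::] -> B s' -> 0 <= r -> pr (path s' `&` walking `&` av s') <= r.
  move=> s0 Bs r0; rewrite (_ : _ `&` _ = set0) /fprob ?measure0 //.
  apply/seteqP; split=> om //= [[/(path_eventP X om s0) e _]] /(_ 0%N).
  by rewrite addn0 e Bs.
have badH H' s' : s' != [::] -> B s' ->
    pr (path s' `&` walking `&` av s') <= (1 - hitp w B H' s') * pr (path s').
  by move=> s0 Bs; apply: bad => //; rewrite hitp_bad // subrr mul0r.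
elim: H s => [|H IH] s s0; have [/badH h|nB] := boolP (B s); try exact: h.
  rewrite /= (negbTE nB) subr0 mul1r; apply: pr_le => //; first exact: measurable_path.
  by move=> om [[]].
rewrite /= (negbTE nB); set s1 := rcons s _; set s2 := rcons s (_ - 1).
have s10 : s1 != [::] by exact: rcons_ne0.
have s20 : s2 != [::] by exact: rcons_ne0.
have sub : path s `&` walking `&` av s `<=`
    (path s1 `&` walking `&` av s1) `|` (path s2 `&` walking `&` av s2).
  move=> om [[sm Am] a].
  have nz : (0 < size s)%N by rewrite lt0n size_eq0.
  have av' j : ~~ B (hist (size s + j) om).
    by have := a j.+1; rewrite addnS -addSn prednK.
  by case: (path_offspring s0 sm Am) => h; [left|right]; split=> // j; rewrite size_rcons.
apply: le_trans (pr_le P (m _) (measurableU _ _ (m _) (m _)) sub) _.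
apply: le_trans (pr_setU_le _ (m _) (m _)) _.
apply: le_trans (lerD (IH _ s10) (IH _ s20)) _.
rewrite /s1 /s2 !pr_rcons //; have := step_sum w_gt0 s.
move: (step s _) (step s _) => p q pq; have -> : q = 1 - p by lra.
by rewrite le_eqVlt; apply/orP; left; apply/eqP; ring.
Qed.

Lemma pr_ever_le B (eta : R) : (forall H, hitp w B H [:: 0] <= eta) ->
  pr (walking `&` [set om | exists n, B (hist n om)]) <= eta.
Proof.
move=> Beta.
pose F H := path [:: 0] `&` walking `&` hits B H [:: 0].
have mF H : measurable (F H).
  apply: measurableI (measurable_hits _ _ _); apply: measurableI (measurable_walking).
  exact: measurable_path.
rewrite (_ : _ `&` _ = \bigcup_H F H); last first.
  apply/seteqP; split=> om.
    move=> [vm [n Bn]]; exists n => //; split; last by exists n.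
    by split=> //; apply/path_eventP => //; case: vm => <- _.
  by move=> [H _ [[_ vm] [j [_ Bj]]]]; split=> //; exists j.
apply: pr_bigcup_le => // H.
  move=> om [h [j [jH Bj]]]; split=> //; exists j; split=> //; exact: leqW.
have p1 : pr (path [:: 0]) <= 1.
  by rewrite -lee_fin -prE; [exact: probability_le1 (measurable_path _)|exact: measurable_path].
have hp : forall s, s != [::] -> B s -> pr (path s `&` walking) <= 1 * pr (path s).
  move=> s s0 _; rewrite mul1r; apply: pr_le; [|exact: measurable_path|by move=> om []].
  by apply: measurableI; [exact: measurable_path|exact: measurable_walking].
have := @pr_hits_le walking B 1 measurable_walking (fun=> id) ler01 hp H [:: 0] isT.
rewrite mul1r => h; apply: (le_trans h); apply: le_trans (Beta H).
by rewrite ler_piMr // hitp_ge0.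
Qed.

End Process.

(** * Empty or everything *)

Definition power_weight (R : realType) (w : nat -> R) : Prop :=
  exists al : R, [/\ 0 <= al, al < 2^-1 &
     exists c C : R, [/\ 0 < c, 0 < C & forall k : nat,
        c * (k.+1%:R `^ al) <= w k /\ w k <= C * (k.+1%:R `^ al)]].

Section PathLemmas.
Variables (T : Type) (X : nat -> T -> int).

Lemma le_loc_time_hist (y : int) (m n : nat) (om : T) : (m <= n)%N ->
  (loc_time (hist X m om) y <= loc_time (hist X n om) y)%N.
Proof.
move=> /subnKC <-; elim: (n - m)%N => [|k IH]; first by rewrite addn0.
by rewrite addnS histS loc_time_rcons (leq_trans IH) // leq_addr.
Qed.

Definition infinitely_often (y : int) (om : T) : Prop :=
  forall N : nat, exists2 n : nat, (N <= n)%N & X n om = y.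

Lemma infinitely_often_loc_time y om (k N : nat) : infinitely_often y om ->
  exists2 n : nat, (N <= n)%N & (k <= loc_time (hist X n om) y)%N.
Proof.
move=> io; elim: k => [|k [n Nn kn]]; first by exists N.
have [[|n'] // nn' Xn'] := io n.+1; exists n'.+1; first exact: leq_trans Nn (ltnW nn').
rewrite histS loc_time_rcons Xn' eqxx addn1 ltnS (leq_trans kn) //.
exact: le_loc_time_hist.
Qed.

Lemma loc_time_hist_bounded y om (N n : nat) :
  (forall m, (N <= m)%N -> X m om != y) -> (loc_time (hist X n om) y <= N)%N.
Proof.
move=> h; elim: n => [|n IH].
  rewrite (_ : hist X 0 om = [:: X 0%N om]) // loc_time1; case: N h => [/(_ 0%N isT)/negbTE ->//|N _].
  by case: (_ == _).
rewrite histS loc_time_rcons; have [Nn|nN] := leqP N n.+1.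
  by rewrite (negbTE (h _ Nn)) addn0.
apply: leq_trans nN; rewrite -(addn1 n.+1) leq_add ?leq_b1 //.
by rewrite -(size_hist X n om) count_size.
Qed.

End PathLemmas.

Section Dichotomy.
Variables (d : measure_display) (T : measurableType d) (R : realType) (P : probability T R).
Variable w : nat -> R.
Hypothesis hw : power_weight w.

Lemma power_weight_gt0 k : 0 < w k.
Proof. by case: hw => al [al0 al2 [c [C [c0 C0 h]]]]; exact: (weight_gt0 c0 (fun k => (h k).1)). Qed.

(** The order of quantifiers matters: [K] comes first so that [N0] can be taken above it, and [N0]
    is uniform in the walk and in the site. *)
Lemma pr_unbalanced : exists K : nat, forall (eta : R) (n1 : nat), 0 < eta ->
  exists2 N0 : nat, (n1 < N0)%N & forall (X : nat -> T -> int) (a : int), is_vrrw P w X ->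
    fprob P (walking X `&` [set om | exists n, (N0 <= loc_time (hist X n om) a)%N /\
      (K * loc_time (hist X n om) (a + 1) <= loc_time (hist X n om) a)%N]) <= eta.
Proof.
case: hw => al [al0 al2 [c [C [c0 C0 h]]]].
have wge k := (h k).1; have wle k := (h k).2.
have [e e0 [K HK]] := leftward_growth al0 al2 c0 C0 wge wle.
exists K => eta n1 eta0.
have [N0 n1N HN] := hitp_deviates_le al2 c0 e0 (weight_ge al0 c0 wge) (n1 + 4) eta0.
exists N0 => [|X a vX]; first exact: leq_ltn_trans (leq_addr _ _) n1N.
have N4 : (4 <= N0)%N by apply: leq_trans (ltnW n1N); exact: leq_addl.
apply: le_trans (pr_ever_le power_weight_gt0 vX (B := deviates w al e N0 a) (HN a)).
apply: pr_le.
- apply: measurableI; first exact: measurable_walking vX.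
  apply: measurable_exists => n.
  exact: (measurable_hist vX (fun s => (N0 <= loc_time s a)%N /\
    (K * loc_time s (a + 1) <= loc_time s a)%N)).
- apply: measurableI; first exact: measurable_walking vX.
  apply: measurable_exists => n; exact: (measurable_hist vX (fun s => deviates w al e N0 a s)).
- move=> om [vm [n [h1 h2]]]; split=> //; exists n; apply/asboolP.
  by apply: HK => //; exact: walk_hist.
Qed.

Section OneWalk.
Variable X : nat -> T -> int.
Hypothesis vX : is_vrrw P w X.

Lemma measurable_infinitely_often y : measurable [set om | infinitely_often X y om].
Proof.
apply: measurable_forall => N.
rewrite (_ : (fun _ => _) = [set om | exists n, (N <= n)%N /\ [set om | X n om = y] om]).
  by apply: measurable_exists => n; exact: measurable_guard (measurable_at vX n y).
by apply/seteqP; split=> om [n] => [Nn Xn|[Nn Xn]]; exists n.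
Qed.

Lemma measurable_eventually_off y :
  measurable [set om | exists N, forall n, (N <= n)%N -> X n om != y].
Proof.
rewrite (_ : [set om | _] = ~` [set om | infinitely_often X y om]).
  by apply: measurableC; exact: measurable_infinitely_often.
apply/seteqP; split=> om /=.
  by move=> [N hN] /(_ N)[n Nn Xn]; move: (hN n Nn); rewrite Xn eqxx.
move=> nio; apply: contrapT => h; apply: nio => N; apply: contrapT => hN.
apply: h; exists N => n Nn; apply/eqP => Xn; apply: hN; by exists n.
Qed.

(** If [a + 1] receives at most [N] visits, the pair is unbalanced once [a] has [N0 + K * N] of
    them; so the event has probability at most [eta] for every [eta]. *)
Lemma pr_gap a : fprob P (walking X `&` [set om | infinitely_often X a om] `&`
  [set om | exists N, forall n, (N <= n)%N -> X n om != a + 1]) = 0.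
Proof.
set E := _ `&` _; have mE : measurable E.
  apply: measurableI; last exact: measurable_eventually_off.
  by apply: measurableI; [exact: measurable_walking vX|exact: measurable_infinitely_often].
have [K HK] := pr_unbalanced.
apply/eqP; rewrite eq_le pr_ge0 andbT; apply/ler_addgt0Pr => eta eta0; rewrite add0r.
have [N0 _ h] := HK eta 0%N eta0; apply: le_trans (h X a vX); apply: pr_le => //.
  apply: measurableI; first exact: measurable_walking vX.
  apply: measurable_exists => n.
  exact: (measurable_hist vX (fun s => (N0 <= loc_time s a)%N /\
    (K * loc_time s (a + 1) <= loc_time s a)%N)).
move=> om [[vm io] [N hN]]; split=> //.
have [n _ hn] := infinitely_often_loc_time (N0 + K * N) 0 io.
exists n; split; first exact: leq_trans (leq_addr _ _) hn.
apply: leq_trans hn; apply: leq_trans (leq_addl _ _).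
by rewrite leq_mul2l (loc_time_hist_bounded _ hN) orbT.
Qed.

End OneWalk.

(** * Reflection of the walk *)

Section Mirror.
Variable X : nat -> T -> int.

Definition mirror (n : nat) (om : T) : int := - X n om.

Lemma loc_time_opp (s : seq int) y : loc_time (map -%R s) y = loc_time s (- y).
Proof. by rewrite /loc_time count_map; apply: eq_count => x /=; rewrite eqr_oppLR. Qed.

Lemma vrrw_step_opp (s : seq int) y : s != [::] ->
  vrrw_step w (map -%R s) (- y) = vrrw_step w s y.
Proof.
move=> s0; rewrite /vrrw_step !loc_time_opp.
have -> : last 0 (map -%R s) = - last 0 s by case: s s0 => // x s _; exact: last_map.
set l := last 0 s.
have -> : - (- l - 1) = l + 1 by lia.
have -> : - (- l + 1) = l - 1 by lia.
have -> : (- y == - l + 1) = (y == l - 1) by lia.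
have -> : (- y == - l - 1) = (y == l + 1) by lia.
rewrite [in LHS](addrC (w _)); have [->|_] := eqVneq y (l - 1); last by case: ifP.
by rewrite (_ : (l - 1 == l + 1) = false) //; lia.
Qed.

Lemma path_mirror (s : seq int) : path_event mirror s = path_event X (map -%R s).
Proof.
apply/seteqP; split=> om h i; rewrite ?size_map => iS.
  by rewrite (nth_map 0) // -h // /mirror opprK.
rewrite /mirror; have := h i; rewrite size_map (nth_map 0) // => /(_ iS) ->.
by rewrite opprK.
Qed.

Lemma is_vrrw_mirror : is_vrrw P w X -> is_vrrw P w mirror.
Proof.
move=> [mX [X0 vX]]; split=> [n x|]; last split.
- rewrite (_ : [set om | _] = [set om | X n om = - x]); first exact: mX.
  apply/seteqP; split=> om /=; rewrite /mirror; first by move=> <-; rewrite opprK.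
  by move=> ->; rewrite opprK.
- rewrite -X0; congr (P _); apply/seteqP; split=> om /=; rewrite /mirror.
    by move/eqP; rewrite oppr_eq0 => /eqP.
  by move=> ->; rewrite oppr0.
- move=> s y s0; rewrite !path_mirror map_rcons vX ?size_map //.
  by rewrite vrrw_step_opp // -size_eq0.
Qed.

Lemma infinitely_often_mirror y om :
  infinitely_often mirror y om <-> infinitely_often X (- y) om.
Proof.
split=> io N; have [n Nn Xn] := io N; exists n => //; last by rewrite /mirror Xn opprK.
by rewrite -Xn /mirror opprK.
Qed.

End Mirror.
End Dichotomy.

Section ZeroInfinity.
Variables (d : measure_display) (T : measurableType d) (R : realType) (P : probability T R).
Variables (w : nat -> R) (X : nat -> T -> int).
Hypotheses (hw : power_weight w) (vX : is_vrrw P w X).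

Lemma transient_pathE om : transient_path X om <-> forall y, ~ infinitely_often X y om.
Proof.
split=> [tr y io|h y].
  by have [N hN] := tr y; have [n Nn Xn] := io N; move: (hN n Nn); rewrite Xn eqxx.
apply: contrapT => hN; apply: (h y) => N; apply: contrapT => nN; apply: hN; exists N => n Nn.
by apply/eqP => Xn; apply: nN; exists n.
Qed.

Lemma measurable_recurrent : measurable (recurrent_path X).
Proof. by apply: measurable_forall => y; exact: measurable_infinitely_often vX y. Qed.

Lemma measurable_transient : measurable (transient_path X).
Proof. by apply: measurable_forall => y; exact: measurable_eventually_off vX y. Qed.

(** Outside countably many null gap events, the set of sites visited infinitely often is stable
    under both unit shifts, hence empty or everything. *)
Lemma pr_recurrent_or_transient : fprob P (recurrent_path X `|` transient_path X) = 1.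
Proof.
have mV := measurable_walking vX.
have mRT := measurableU _ _ measurable_recurrent measurable_transient.
suff : fprob P (~` (recurrent_path X `|` transient_path X)) = 0.
  by rewrite pr_setC //; lra.
have vX' := is_vrrw_mirror vX.
pose gap (Y : nat -> T -> int) (a : int) := walking Y `&` [set om | infinitely_often Y a om] `&`
  [set om | exists N, forall n, (N <= n)%N -> Y n om != a + 1].
have mgap Y a : is_vrrw P w Y -> measurable (gap Y a).
  move=> vY; apply: measurableI; last exact: measurable_eventually_off vY _.
  by apply: measurableI; [exact: measurable_walking vY|exact: measurable_infinitely_often vY _].
pose F (i : option (int + int)) := match i with
  | None => ~` walking X | Some (inl a) => gap X a | Some (inr a) => gap (mirror X) a end.
have mF i : measurable (F i).
  by case: i => [[a|a]|]; [exact: mgap|exact: mgap|exact: measurableC].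
have F0 i : fprob P (F i) = 0.
  case: i => [[a|a]|]; [exact: (pr_gap hw vX)|exact: (pr_gap hw vX')|].
  by rewrite pr_setC // (pr_walking (power_weight_gt0 hw) vX) subrr.
apply: pr_sub_eq0 (pr_exists_eq0 mF F0); [exact: measurableC|exact: measurable_exists|].
move=> om nRT; apply: contrapT => nF; apply: nRT.
have vm : walking X om by apply: contrapT => nv; apply: nF; exists None.
have vm' : walking (mirror X) om.
  case: vm => x0 nb; split; first by rewrite /mirror x0 oppr0.
  by move=> n; have := nb n; rewrite /nbr /mirror; lia.
have up a : infinitely_often X a om -> infinitely_often X (a + 1) om.
  move=> io N; apply: contrapT => h; apply: nF; exists (Some (inl a)); split=> //.
  by exists N => n Nn; apply/eqP => Xn; apply: h; exists n.
(* A gap of the mirror walk at [- a] is a gap of [X] between [a] and [a - 1]. *)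
have down a : infinitely_often X a om -> infinitely_often X (a - 1) om.
  move=> io N; apply: contrapT => h; apply: nF; exists (Some (inr (- a))); split.
    by split=> //; apply/infinitely_often_mirror; rewrite opprK.
  exists N => n Nn; apply/eqP => Xn; apply: h; exists n => //.
  by move: Xn; rewrite /mirror; lia.
have [[y io]|nio] := pselect (exists y, infinitely_often X y om); last first.
  by right; apply/transient_pathE => y io; apply: nio; exists y.
left => z.
have upn (k : nat) : infinitely_often X (y + k%:Z) om.
  elim: k => [|k IH]; first by rewrite addr0.
  by have := up _ IH; rewrite (_ : y + k%:Z + 1 = y + k.+1%:Z) //; lia.
have downn (k : nat) : infinitely_often X (y - k%:Z) om.
  elim: k => [|k IH]; first by rewrite subr0.
  by have := down _ IH; rewrite (_ : y - k%:Z - 1 = y - k.+1%:Z) //; lia.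
have [h|h] := leP y z.
  by rewrite (_ : z = y + `|z - y|%N%:Z); [exact: upn|lia].
by rewrite (_ : z = y - `|z - y|%N%:Z); [exact: downn|lia].
Qed.

End ZeroInfinity.

(** * The zero-one law *)

Lemma loc_time_cat (s t : seq int) y : loc_time (s ++ t) y = (loc_time s y + loc_time t y)%N.
Proof. exact: count_cat. Qed.

Lemma loc_time_shift (s : seq int) a y : loc_time (map (fun x => x + a) s) y = loc_time s (y - a).
Proof.
by rewrite /loc_time count_map; apply: eq_count => x /=; rewrite -subr_eq opprK // -(subr_eq x).
Qed.

Lemma nbr_shift (a b c : int) : nbr (a + c) (b + c) = nbr a b.
Proof. by rewrite /nbr; lia. Qed.

Lemma shift_gt (x a : int) : 0 <= a -> x < a + (x + 1).
Proof. by lia. Qed.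

Lemma eq_pred_of_lt (x y : int) : x - 1 <= y -> y < x -> y = x - 1.
Proof. by lia. Qed.

(* Every excursion of [s] below 1 becomes a single visit to 0. *)
Lemma collapse_below (s : seq int) : s != [::] -> walk s -> head 0 s = 0 ->
  exists r : seq int, [/\ path nbr 0 r, all (fun y => 0 <= y) r,
    forall y, 1 <= y -> loc_time (0 :: r) y = loc_time s y & last 0 r = Num.max (last 0 s) 0].
Proof.
move: s; apply: history_ind => [x _ /= x0|s y s0 IH].
  by exists [::]; split=> //=; [move=> y _; rewrite x0|rewrite x0 maxxx].
rewrite walk_rcons // => /andP[ws nb] h0.
have [r [pr ar lr la]] : exists r : seq int, [/\ path nbr 0 r, all (fun y => 0 <= y) r,
    forall y, 1 <= y -> loc_time (0 :: r) y = loc_time s y & last 0 r = Num.max (last 0 s) 0].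
  by apply: IH => //; move: h0; case: (s) s0.
have [y1|y1] := leP 1 y.
  exists (rcons r y); split.
  - by rewrite rcons_path pr la /=; move: (last 0 s) nb => l; rewrite /nbr; case: leP; lia.
  - by rewrite all_rcons ar andbT; lia.
  - by move=> z z1; rewrite -rcons_cons !loc_time_rcons lr.
  - by rewrite !last_rcons; case: leP; lia.
(* Only the step from 1 to 0 that opens an excursion is recorded; further steps below 1 leave [r]
   unchanged. *)
have [l1|l1] := leP 1 (last 0 s).
  exists (rcons r 0); split.
  - by rewrite rcons_path pr la /=; move: (last 0 s) nb l1 => l; rewrite /nbr; case: leP; lia.
  - by rewrite all_rcons ar.
  - move=> z z1; rewrite -rcons_cons !loc_time_rcons lr //; congr (_ + nat_of_bool _)%N; lia.
  - by rewrite !last_rcons; move: (last 0 s) nb l1 => l; rewrite /nbr; case: leP; lia.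
exists r; split=> //.
- by move=> z z1; rewrite loc_time_rcons lr // (_ : (y == z) = false) ?addn0 //; lia.
- by rewrite la last_rcons; move: l1; do 2!case: leP; lia.
Qed.

Section Transitions.
Variables (R : realType) (w : nat -> R).
Hypothesis w_gt0 : forall k, 0 < w k.

Lemma weights_pinched (B : nat) :
  exists lo hi : R, [/\ 0 < lo, lo <= hi & forall k, (k <= B)%N -> lo <= w k <= hi].
Proof.
elim: B => [|B [lo [hi [lo0 lohi h]]]].
  by exists (w 0%N), (w 0%N); split=> // k; rewrite leqn0 => /eqP ->; rewrite lexx.
exists (Num.min lo (w B.+1)), (Num.max hi (w B.+1)); split.
- by rewrite lt_min lo0 w_gt0.
- by rewrite ge_min !le_max lohi.
- move=> k; rewrite leq_eqVlt => /orP[/eqP ->|kB]; first by rewrite ge_min le_max !lexx !orbT.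
  by have /andP[h1 h2] := h k kB; rewrite ge_min le_max h1 h2.
Qed.

(** Only the weights at the two neighbouring local times enter, and their indices are among the
    finitely many up to [B]. *)
Lemma step_lower (B : nat) : exists k1 : R, [/\ 0 < k1, k1 <= 1 & forall s y,
  nbr (last 0 s) y -> (loc_time s (last 0 s + 1)%R <= B)%N -> (loc_time s (last 0 s - 1)%R <= B)%N ->
  k1 <= vrrw_step w s y].
Proof.
have [lo [hi [lo0 lohi h]]] := weights_pinched B.
have hi0 : 0 < hi by exact: lt_le_trans lohi.
exists (lo / (2 * hi)); split.
- by rewrite divr_gt0 // mulr_gt0.
- by rewrite ler_pdivrMr ?mulr_gt0 //; lra.
- move=> s y nb /h/andP[r1 r2] /h/andP[l1 l2].
  case/orP: nb => /eqP ->; rewrite ?step_right ?step_left.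
    rewrite ler_pM ?invr_ge0 ?(ltW lo0) //; first by rewrite mulr_ge0 ?(ltW hi0).
    by rewrite lef_pV2 ?posrE ?mulr_gt0 ?addr_gt0 //; lra.
  rewrite ler_pM ?invr_ge0 ?(ltW lo0) //; first by rewrite mulr_ge0 ?(ltW hi0).
  by rewrite lef_pV2 ?posrE ?mulr_gt0 ?addr_gt0 //; lra.
Qed.

End Transitions.

(** From the left neighbour of the last position onwards all local times are bounded, so a
    prescribed continuation there costs a bounded factor; the sites beyond are new, leaving room for
    a translated copy. *)
Definition fresh_max (N0 : nat) (g : seq int) : bool :=
  `[< (forall y, last 0 g <= y -> loc_time g y = (y == last 0 g)) /\
      (loc_time g (last 0 g - 1)%R < N0)%N >].

(** A nearest-neighbour path cannot jump over [k], so it stays below [k] until it first visits it,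
    which takes at least [k] steps. *)
Lemma first_hit (T : Type) (X : nat -> T -> int) om (k : nat) : walking X om ->
  (0 < k)%N -> (exists m, X m om = k%:Z) ->
  exists n, [/\ (k <= n)%N, X n om = k%:Z &
    forall y, k%:Z <= y -> loc_time (hist X n om) y = (y == k%:Z)].
Proof.
move=> [x0 nb] k0 [m Xm].
have ex : exists n, X n om == k%:Z by exists m; apply/eqP.
case: (ex_minnP ex) => n /eqP Xn nmin.
have below i : (i < n)%N -> X i om < k%:Z.
  elim: i => [|i IH] iN; first by rewrite x0; lia.
  have := IH (ltnW iN); have := nb i; rewrite /nbr.
  have : X i.+1 om != k%:Z by apply/negP => /nmin; rewrite leqNgt iN.
  lia.
have slow i : X i om <= i%:Z.
  elim: i => [|i IH]; first by rewrite x0.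
  by have := nb i; rewrite /nbr; lia.
have kn : (k <= n)%N by have := slow n; rewrite Xn; lia.
exists n; split=> // y ky.
case: n => [|n] in Xn nmin below kn *; first by lia.
rewrite histS loc_time_rcons Xn eq_sym.
suff -> : loc_time (hist X n om) y = 0%N by [].
have : forall i, (i <= n)%N -> loc_time (hist X i om) y = 0%N.
  elim=> [|i IH] iN.
    have ne : (X 0%N om == y) = false by have := below 0%N isT; lia.
    by rewrite (_ : hist X 0 om = [:: X 0%N om]) // loc_time1 ne.
  have ne : (X i.+1 om == y) = false by have := below i.+1 iN; lia.
  by rewrite histS loc_time_rcons ne addn0; apply: IH; exact: ltnW.
by apply.
Qed.

(** * Escape against recurrence *)

Section ZeroOne.
Import numFieldNormedType.Exports.
Variables (d : measure_display) (T : measurableType d) (R : realType) (P : probability T R).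
Variables (w : nat -> R) (X : nat -> T -> int).
Hypotheses (hw : power_weight w) (vX : is_vrrw P w X).
Let w_gt0 : forall k, 0 < w k := power_weight_gt0 hw.
Let mpath s : measurable (path_event X s) := measurable_path vX s.
Let mwalking : measurable (walking X) := measurable_walking vX.

(** Above level 1 the walk consults only local times at sites from 1 on, exactly those that
    [collapse_below] preserves. *)
Definition escapes : set T :=
  walking X `&` [set om | exists n, forall j, 1 < X (n + j)%N om].

Lemma measurable_escapes : measurable escapes.
Proof.
apply: measurableI mwalking _; apply: measurable_exists => n; apply: measurable_forall => j.
rewrite (_ : (fun _ => _) = [set om | (fun s => 1 < last 0 s) (hist X (n + j) om)]).
  exact: (measurable_hist vX (fun s => 1 < last 0 s)).
by apply/funext => om; rewrite /mkset last_hist.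
Qed.

(** Escape is covered by countably many events, one for each history after which the walk stays
    above 1; one of them has positive mass. *)
Lemma escape_history : 0 < fprob P escapes -> exists s, exists2 rho : R, 0 < rho &
  [/\ s != [::], walk s, head 0 s = 0, 1 < last 0 s &
      forall H, hitp w (fun t => last 0 t <= 1) H s <= 1 - rho].
Proof.
move=> esc0.
pose E s := path_event X s `&` walking X `&`
  [set om | forall j, ~~ (last 0 (hist X ((size s).-1 + j) om) <= 1)].
have mE s : measurable (E s).
  apply: measurableI; first exact: measurableI (mpath s) mwalking.
  apply: measurable_forall => j; exact: (measurable_hist vX (fun t => ~~ (last 0 t <= 1))).
have [s s0 Es] : exists2 s, s != [::] & fprob P (E s) != 0.
  apply: contrapT => none; move: esc0; rewrite ltNge => /negP; apply.
  pose F s := [set om | s != [::] /\ E s om].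
  have mF s : measurable (F s) by exact: measurable_guard.
  have F0 s : fprob P (F s) = 0.
    have [s0|s0] := eqVneq s [::].
      by rewrite (_ : F s = set0) ?/fprob ?measure0 //; apply/seteqP; split=> om //= []; rewrite s0.
    rewrite (_ : F s = E s); last by apply/seteqP; split=> om [].
    by apply: contrapT => /eqP ne; apply: none; exists s.
  rewrite (_ : fprob P escapes = 0) //.
  apply: pr_sub_eq0 (pr_exists_eq0 mF F0); [exact: measurable_escapes|exact: measurable_exists|].
  move=> om [vm [n hn]]; exists (hist X n om); split; first exact: hist_ne0.
  split; first by split=> //; exact: path_hist.
  by move=> j; rewrite size_hist last_hist -ltNge; exact: hn.
have Egt0 : 0 < fprob P (E s) by rewrite lt0r Es pr_ge0.
have [om [[sm vm] av]] : exists om, E s om.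
  apply: contrapT => none; move: Es; rewrite (_ : E s = set0) ?/fprob ?measure0 ?eqxx //.
  by apply/seteqP; split=> om // Eom; apply: none; exists om.
have es := (path_eventP X om s0).1 sm.
(* The unconditional mass serves as [rho], since conditioning on [s] can only increase it. *)
exists s, (fprob P (E s)) => //; split => //.
- by rewrite -es; exact: walk_hist.
- by rewrite -es; case: vm.
- by have := av 0%N; rewrite addn0 es -ltNge.
- move=> H; rewrite lerBrDl -lerBrDr.
  apply: le_trans (pr_avoids_le w_gt0 vX (fun t => last 0 t <= 1) H s0) _.
  rewrite ler_piMr ?subr_ge0 ?hitp_le1 //.
  by rewrite -lee_fin -prE //; exact: probability_le1.
Qed.

Variable N0 : nat.

Definition often_fresh : set T :=
  recurrent_path X `&` walking X `&`
  [set om | forall n, exists m, (n <= m)%N /\ fresh_max N0 (hist X m om)].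

Lemma measurable_often_fresh : measurable often_fresh.
Proof.
apply: measurableI; first exact: measurableI (measurable_recurrent vX) mwalking.
apply: measurable_forall => n; apply: measurable_exists => m; apply: measurable_guard.
exact: (measurable_hist vX (fun s => fresh_max N0 s)).
Qed.

Let mA := measurable_often_fresh.

(** Price of forcing the walk to follow [t]: staying at or right of the last site of [g], it
    consults only sites whose local times remain at most [B]. *)
Lemma pr_extend_ge (t : seq int) (B : nat) (k1 : R) : 0 < k1 ->
  (forall s y, nbr (last 0 s) y -> (loc_time s (last 0 s + 1)%R <= B)%N ->
    (loc_time s (last 0 s - 1)%R <= B)%N -> k1 <= vrrw_step w s y) ->
  forall g, g != [::] -> path nbr (last 0 g) t -> all (fun y => last 0 g <= y) t ->
  (forall y, last 0 g - 1 <= y -> (loc_time g y + size t <= B)%N) ->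
  k1 ^+ size t * fprob P (path_event X g) <= fprob P (path_event X (g ++ t)).
Proof.
move=> k10 Hk; elim/last_ind: t => [|t y IH] g g0.
  by rewrite cats0 expr0 mul1r.
rewrite rcons_path all_rcons size_rcons => /andP[pt nb] /andP[ly at_] HB.
have gt0 : g ++ t != [::] by case: (g) g0.
have lgt : last 0 (g ++ t) = last (last 0 g) t by rewrite last_cat.
have lge : last 0 g <= last 0 (g ++ t).
  rewrite lgt; case/lastP: (t) at_ => // t' z; rewrite all_rcons last_rcons => /andP[] //.
have loc_le z : last 0 g - 1 <= z -> (loc_time (g ++ t) z <= B)%N.
  move=> /HB h; rewrite loc_time_cat; apply: leq_trans h; rewrite leq_add2l.
  by apply: leqW; exact: count_size.
rewrite -rcons_cat (pr_rcons vX) // exprSr mulrAC ler_pM //.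
- by rewrite mulr_ge0 ?pr_ge0 // exprn_ge0 // ltW.
- exact: ltW.
- by apply: IH => // z /HB h; apply: leq_trans h; rewrite leq_add2l.
- by apply: Hk; rewrite ?lgt //; apply: loc_le; move: lge; rewrite lgt; lia.
Qed.

(** The deficit is nonnegative on every history and at least the sum of the deficits of its two
    extensions, so any gain found after an extension is inherited by the prefix. *)
Lemma deficit_mono (th : R) :
  (forall s, s != [::] -> fprob P (path_event X s `&` often_fresh) <= th * fprob P (path_event X s)) ->
  forall t g, g != [::] -> path nbr (last 0 g) t ->
  th * fprob P (path_event X (g ++ t)) - fprob P (path_event X (g ++ t) `&` often_fresh) <=
  th * fprob P (path_event X g) - fprob P (path_event X g `&` often_fresh).
Proof.
move=> Hth; elim/last_ind => [|t y IH] g g0; first by rewrite cats0.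
rewrite rcons_path => /andP[pt nb]; apply: le_trans (IH g g0 pt).
rewrite -rcons_cat; set s := g ++ t.
have s0 : s != [::] by rewrite /s; case: (g) g0.
have nbs : nbr (last 0 s) y by rewrite /s last_cat.
have split_le : fprob P (path_event X s `&` often_fresh) <=
    fprob P (path_event X (rcons s (last 0 s + 1)) `&` often_fresh) +
    fprob P (path_event X (rcons s (last 0 s - 1)) `&` often_fresh).
  have mi u : measurable (path_event X u `&` often_fresh) by exact: measurableI (mpath u) mA.
  apply: le_trans (pr_setU_le P (mi _) (mi _)).
  apply: pr_le => //; first exact: measurableU.
  move=> om [sm Am]; have vm : walking X om by case: Am => -[].
  by case: (path_offspring s0 sm vm) => h; [left|right].
have := pr_offspring w_gt0 vX s0.
have h1 := Hth _ (rcons_ne0 s (last 0 s + 1)).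
have h2 := Hth _ (rcons_ne0 s (last 0 s - 1)).
move=> ->; rewrite mulrDr.
by case/orP: nbs => /eqP ->; move: split_le h1 h2; lra.
Qed.

(** From a fresh maximum, forcing a translated copy of the escaping history costs [kap], after which
    the walk fails to return with probability at least [rho]; a uniform bound [th] thus improves by
    the factor [1 - rho * kap]. *)
Lemma contraction : 0 < fprob P escapes -> exists2 q : R, 0 <= q < 1 &
  forall th, 0 <= th ->
  (forall s, s != [::] -> fprob P (path_event X s `&` often_fresh) <= th * fprob P (path_event X s)) ->
  forall s, s != [::] -> fprob P (path_event X s `&` often_fresh) <= th * q * fprob P (path_event X s).
Proof.
move=> /escape_history[s [rho rho0 [s0 ws hs ls Hs]]].
have [r [nr ar lr la]] := collapse_below s0 ws hs.
have lr1 : last 0 r = last 0 s by rewrite la; case: leP; lia.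
(* Local times from [x - 1] on start below [N0] or at most 1, and the forced word adds at most its
   length [(size r).+1]. *)
have [k1 [k10 k11 Hk]] := step_lower w_gt0 (N0 + 1 + (size r).+1)%N.
pose kap := k1 ^+ (size r).+1.
have kap0 : 0 < kap by rewrite exprn_gt0.
have kap1 : kap <= 1 by rewrite exprn_ile1 // ltW.
have rho1 : rho <= 1 by have := le_trans (hitp_ge0 w_gt0 _ 0 s) (Hs 0%N); lra.
have rk0 : 0 < rho * kap by rewrite mulr_gt0.
have rk1 : rho * kap <= 1 by rewrite mulr_ile1 // ltW.
exists (1 - rho * kap); first by apply/andP; split; lra.
move=> th th0 Hth.
have mi u : measurable (path_event X u `&` often_fresh) by exact: measurableI (mpath u) mA.
have good g : g != [::] -> fresh_max N0 g ->
    fprob P (path_event X g `&` often_fresh) <= th * (1 - rho * kap) * fprob P (path_event X g).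
  move=> g0 /asboolP[fr ltN]; set x := last 0 g in fr ltN *.
  (* The origin of the copy is placed at the unvisited site [x + 1], so beyond it [g] contributes no
     local time. *)
  pose t := map (fun y => y + (x + 1)) (0 :: r).
  have pt : path nbr x t.
    rewrite /t /= add0r {1}/nbr eqxx /=.
    have shift : path nbr (0 + (x + 1)) (map (fun y => y + (x + 1)) r) =
        path (relpre (fun y => y + (x + 1)) nbr) 0 r by exact: path_map.
    rewrite add0r in shift; rewrite shift.
    by rewrite (eq_path (e' := nbr)) // => a b; exact: nbr_shift.
  have at_ : all (fun y => x <= y) t.
    apply/allP => _ /mapP[a ra ->]; apply/ltW/shift_gt.
    by move: ra; rewrite in_cons => /orP[/eqP -> //|ra]; exact: (allP ar).
  have st : size t = (size r).+1 by rewrite /t size_map.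
  pose q := g ++ t.
  have q0 : q != [::] by rewrite /q; case: (g) g0.
  have ext : kap * fprob P (path_event X g) <= fprob P (path_event X q).
    rewrite /kap -st; apply: (@pr_extend_ge t (N0 + 1 + (size r).+1)%N) => // y xy.
    rewrite st leq_add2r; have [xy'|yx] := leP x y; first by rewrite fr // (leq_trans (leq_b1 _)) ?leq_addl.
    by rewrite (eq_pred_of_lt xy yx) (leq_trans (ltnW ltN)) ?leq_addr.
  have lq : last 0 q = last 0 s + (x + 1).
    by rewrite /q last_cat -lr1; exact: (last_map (fun y => y + (x + 1)) r 0).
  have locq y : 1 <= y -> loc_time q (y + (x + 1)) = loc_time s y.
    move=> y1; have xy : x < y + (x + 1) by apply: shift_gt; exact: le_trans y1.
    by rewrite /q loc_time_cat loc_time_shift addrK lr // fr ?(ltW xy) // gt_eqF.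
  (* Recurrence forces a return to the level of the copy, which has probability at most [1 - rho];
     from there the bound [th] applies again. *)
  have ret : fprob P (path_event X q `&` often_fresh) <= th * (1 - rho) * fprob P (path_event X q).
    pose B (u : seq int) := last 0 u <= 1 + (x + 1).
    pose F H := path_event X q `&` often_fresh `&` hits X B H q.
    have mF H : measurable (F H) by exact: measurableI (mi q) (measurable_hits vX B H q).
    rewrite (_ : _ `&` _ = \bigcup_H F H); last first.
      apply/seteqP; split=> om; last by move=> [H _ []].
      move=> [qm Am]; have [[rec _] _] := Am.
      have [n qn Xn] := rec (1 + (x + 1)) (size q).
      exists n => //; split=> //; exists (n - (size q).-1)%N; split; first exact: leq_subr.
      by rewrite subnKC /B ?last_hist ?Xn // (leq_trans (leq_pred _)).
    apply: pr_bigcup_le => // [H om [h [j [jH Bj]]]|H].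
      by split=> //; exists j; split=> //; exact: leqW.
    have Aw : often_fresh `<=` walking X by move=> om [[]].
    apply: le_trans (pr_hits_le vX (B := B) mA Aw th0 (fun u u0 _ => Hth u u0) H q0) _.
    rewrite ler_wpM2r ?pr_ge0 // ler_wpM2l //.
    by rewrite (@hitp_shift _ w 1 (x + 1) H s q).
  have := deficit_mono Hth g0 pt; rewrite -/q.
  move: ret ext (pr_ge0 P (path_event X g)).
  set a := fprob P (path_event X q `&` _); set b := fprob P (path_event X q).
  set c := fprob P (path_event X g `&` _); set e := fprob P (path_event X g).
  move=> h1 h2 h3 h4.
  have h5 : th * rho * (kap * e) <= th * rho * b by rewrite ler_wpM2l // mulr_ge0 // ltW.
  move: h1 h4 h5; rewrite !mulrBr !mulrBl !mulr1 !mulrA; lra.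
(* On [often_fresh] a fresh maximum is met after any history [u], so the improved bound transfers to
   [u]. *)
move=> u u0.
pose F H := path_event X u `&` often_fresh `&` hits X (fresh_max N0) H u.
have mF H : measurable (F H) by exact: measurableI (mi u) (measurable_hits vX _ H u).
rewrite (_ : _ `&` _ = \bigcup_H F H); last first.
  apply/seteqP; split=> om; last by move=> [H _ []].
  move=> [um Am]; have [n [un fn]] := Am.2 (size u).
  exists n => //; split=> //; exists (n - (size u).-1)%N; split; first exact: leq_subr.
  by rewrite subnKC // (leq_trans (leq_pred _)).
apply: pr_bigcup_le => // [H om [h [j [jH Bj]]]|H].
  by split=> //; exists j; split=> //; exact: leqW.
have Aw : often_fresh `<=` walking X by move=> om [[]].
have tq0 : 0 <= th * (1 - rho * kap) by rewrite mulr_ge0 // subr_ge0.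
apply: le_trans (pr_hits_le vX mA Aw tq0 good H u0) _.
by rewrite ler_wpM2r ?pr_ge0 // ler_piMr // hitp_le1.
Qed.

(** The trivial bound [th = 1] is improved by iterating [contraction], and the powers of [q] tend to
    0. *)
Lemma pr_often_fresh : 0 < fprob P escapes -> fprob P often_fresh = 0.
Proof.
move=> /contraction[q /andP[q0 q1] Hq].
have iter k : forall s, s != [::] ->
    fprob P (path_event X s `&` often_fresh) <= q ^+ k * fprob P (path_event X s).
  elim: k => [|k IH] s s0; last by rewrite exprSr; apply: Hq => //; exact: exprn_ge0.
  by rewrite mul1r; apply: pr_le => //; exact: measurableI (mpath s) mA.
apply/eqP; rewrite eq_le pr_ge0 andbT.
have le_k k : fprob P often_fresh <= q ^+ k.
  apply: (@le_trans _ _ (q ^+ k * fprob P (path_event X [:: 0]))).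
    apply: le_trans (iter k [:: 0] isT); apply: pr_le => //.
      exact: measurableI (mpath _) mA.
    move=> om Am; split=> //; apply/path_eventP => //.
    by have [[_ [x0 _]] _] := Am; rewrite -x0.
  by rewrite ler_piMr ?exprn_ge0 // -lee_fin -prE //; exact: probability_le1.
have cv : q ^+ k @[k --> \oo] --> (0 : R) by apply: cvg_expr; rewrite ger0_norm.
rewrite -(cvg_lim _ cv) //; apply: limr_ge; first by apply/cvg_ex; exists 0.
by apply: nearW.
Qed.

End ZeroOne.

Section Conclusion.
Variables (d : measure_display) (T : measurableType d) (R : realType) (P : probability T R).
Variables (w : nat -> R).
Hypotheses (hw : power_weight w).

Lemma pr_recurrent_eq0 (X : nat -> T -> int) : is_vrrw P w X ->
  0 < fprob P (escapes X) -> fprob P (recurrent_path X) = 0.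
Proof.
move=> vX esc0; apply/eqP; rewrite eq_le pr_ge0 andbT.
apply/ler_addgt0Pr => eta eta0; rewrite add0r.
have [K HK] := pr_unbalanced P hw.
have [N0 KN0 HN0] := HK eta K eta0.
have mR := measurable_recurrent vX; have mV := measurable_walking vX.
pose U (a : int) := walking X `&` [set om | exists n, (N0 <= loc_time (hist X n om) a)%N /\
      (K * loc_time (hist X n om) (a + 1) <= loc_time (hist X n om) a)%N].
have mU a : measurable (U a).
  apply: measurableI mV _; apply: measurable_exists => n.
  exact: (measurable_hist vX (fun s => (N0 <= loc_time s a)%N /\
    (K * loc_time s (a + 1) <= loc_time s a)%N)).
pose C n := recurrent_path X `&` walking X `&`
  [set om | forall m, (n <= m)%N -> ~~ fresh_max N0 (hist X m om)].
have mC n : measurable (C n).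
  apply: measurableI; first exact: measurableI mR mV.
  apply: measurable_forall => m.
  exact: (measurable_hist vX (fun s => (n <= m)%N -> ~~ fresh_max N0 s)).
have CU n : C n `<=` U n%:Z.
  move=> om [[rec vm] nf]; split=> //.
  (* Site [n + 1] cannot be reached before time [n + 1], so on [C n] its first visit is not a fresh
     maximum, which forces at least [N0] earlier visits to [n]. *)
  have [m [nm Xm frm]] : exists m, [/\ (n.+1 <= m)%N, X m om = n.+1%:Z &
      forall y, n.+1%:Z <= y -> loc_time (hist X m om) y = (y == n.+1%:Z)].
    by apply: first_hit => //; have [m _ Xm] := rec n.+1%:Z 0%N; exists m.
  have big : (N0 <= loc_time (hist X m om) n%:Z)%N.
    rewrite leqNgt; apply: contraNN (nf m (ltnW nm)) => lt; apply/asboolP.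
    rewrite last_hist Xm; split=> //.
    by rewrite (_ : n.+1%:Z - 1 = n%:Z) //; lia.
  exists m; split=> //; rewrite (_ : n%:Z + 1 = n.+1%:Z); last by lia.
  by rewrite frm // eqxx muln1 (leq_trans (ltnW KN0)).
have prC : fprob P (\bigcup_n C n) <= eta.
  apply: pr_bigcup_le => // [n om [h nf]|n]; first by split=> // m /ltnW; exact: nf.
  exact: le_trans (pr_le P (mC n) (mU n%:Z) (CU n)) (HN0 X n%:Z vX).
have mbC : measurable (\bigcup_n C n) by exact: bigcup_measurable.
have mA := measurable_often_fresh vX N0.
have sub : recurrent_path X `<=` (often_fresh X N0 `|` \bigcup_n C n) `|` ~` walking X.
  move=> om rec; have [vm|] := pselect (walking X om); last by right.
  left; apply: contrapT => h; apply: (h); left; split=> // n.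
  apply: contrapT => no; apply: h; right; exists n => //; split=> // m nm.
  by apply/negP => f; apply: no; exists m.
apply: le_trans (pr_le P mR (measurableU _ _ (measurableU _ _ mA mbC) (measurableC mV)) sub) _.
apply: le_trans (pr_setU_le P (measurableU _ _ mA mbC) (measurableC mV)) _.
rewrite pr_setC // (pr_walking (power_weight_gt0 hw) vX) subrr addr0.
apply: le_trans (pr_setU_le P mA mbC) _.
by rewrite (pr_often_fresh hw vX N0 esc0) add0r.
Qed.

(** Once -1, 0 and 1 are left for good, the walk keeps its sign. *)
Lemma transient_escapes (X : nat -> T -> int) om : walking X om -> transient_path X om ->
  escapes X om \/ escapes (mirror X) om.
Proof.
move=> vm tr; have nb := vm.2.
have [a ha] := tr 0; have [b hb] := tr 1; have [c hc] := tr (-1).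
pose n := (a + b + c)%N.
have off m : (n <= m)%N -> [/\ X m om != 0, X m om != 1 & X m om != -1].
  by rewrite /n => nm; split; [apply: ha|apply: hb|apply: hc]; lia.
have [pos|neg] := leP 1 (X n om); [left|right]; split.
- exact: vm.
- exists n => j; elim: j => [|j IH].
    by have [h0 h1 h2] := off n (leqnn n); rewrite addn0; lia.
  have [] := off (n + j.+1)%N (leq_addr _ _); have := nb (n + j)%N.
  by rewrite -addnS /nbr; lia.
- case: vm => x0 _; split; first by rewrite /mirror x0 oppr0.
  by move=> m; have := nb m; rewrite /nbr /mirror; lia.
- exists n => j; rewrite /mirror; elim: j => [|j IH].
    by have [h0 h1 h2] := off n (leqnn n); rewrite addn0; lia.
  have [] := off (n + j.+1)%N (leq_addr _ _); have := nb (n + j)%N.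
  by rewrite -addnS /nbr; lia.
Qed.

Lemma recurrent_mirror (X : nat -> T -> int) : recurrent_path (mirror X) = recurrent_path X.
Proof.
apply/seteqP; split=> om rec y.
  by have := (infinitely_often_mirror X (- y) om).1 (rec (- y)); rewrite opprK.
exact: (infinitely_often_mirror X y om).2 (rec (- y)).
Qed.

End Conclusion.

Theorem theorem1p1 (d : measure_display) (T : measurableType d) (R : realType)
  (P : probability T R) (w : nat -> R) (X : nat -> T -> int) :
  (forall k, 0 < w k) ->
  (exists alpha : R, [/\ 0 <= alpha, alpha < 2^-1 &
     exists c C : R, [/\ 0 < c, 0 < C & forall k : nat,
        c * (k.+1%:R `^ alpha) <= w k /\ w k <= C * (k.+1%:R `^ alpha)]]) ->
  is_vrrw P w X ->
  P (recurrent_path X) = 1%E \/ P (transient_path X) = 1%E.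
Proof.
move=> w_gt0 hw vX; have mR := measurable_recurrent vX; have mT := measurable_transient vX.
have mV := measurable_walking vX; have vX' := is_vrrw_mirror vX.
have RT := pr_recurrent_or_transient hw vX.
have := pr_setU_le P mR mT; rewrite RT => le1.
have le_1 (A : set T) : measurable A -> fprob P A <= 1.
  by move=> mA; rewrite -lee_fin -prE //; exact: probability_le1.
have eq1 (A : set T) : measurable A -> 1 <= fprob P A -> P A = 1%E.
  by move=> mA h; rewrite prE //; congr (_%:E); apply/eqP; rewrite eq_le le_1.
have [T0|T0] := eqVneq (fprob P (transient_path X)) 0.
  by left; apply: eq1 => //; move: le1; rewrite T0 addr0.
right; apply: eq1 => //.
suff R0 : fprob P (recurrent_path X) = 0 by move: le1; rewrite R0 add0r.
have mE := measurable_escapes vX; have mE' := measurable_escapes vX'.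
have sub : transient_path X `<=` (escapes X `|` escapes (mirror X)) `|` ~` walking X.
  move=> om tr; have [vm|] := pselect (walking X om); last by right.
  by left; exact: transient_escapes.
have := pr_le P mT (measurableU _ _ (measurableU _ _ mE mE') (measurableC mV)) sub.
move=> /le_trans/(_ (pr_setU_le P (measurableU _ _ mE mE') (measurableC mV))).
rewrite pr_setC // (pr_walking w_gt0 vX) subrr addr0.
move=> /le_trans/(_ (pr_setU_le P mE mE')) leE.
have Tgt0 : 0 < fprob P (transient_path X) by rewrite lt0r T0 pr_ge0.
(* Positive probability of transience gives escape to the right with positive probability for [X] or
   for its mirror image, and both have the same recurrence event. *)
have [E0|E0] := ltP 0 (fprob P (escapes X)); first exact: pr_recurrent_eq0 hw _ vX E0.
rewrite -recurrent_mirror; apply: pr_recurrent_eq0 hw _ vX' _; lra.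
Qed.
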